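(* Let $U\subseteq\mathbb{R}$ be an open interval. Every convex function $f:U\to\mathbb{R}$ can be approximated by real analytic convex functions in the $C^0$-fine topology; that is, for every continuous function $\varepsilon:U\to(0,\infty)$ there exists a real analytic convex function $g:U\to\mathbb{R}$ such that $|f(x)-g(x)|\leq\varepsilon(x)$ for all $x\in U$. *)

(* Defs.v *)
From Stdlib Require Export Reals.
From Coquelicot Require Export Coquelicot.

Open Scope R_scope.

(* The endpoints lie in the extended reals, so bounded intervals, half-lines
   and the whole line are all covered.  A function on U is represented by a
   total function R -> R whose values outside U play no role. *)
Definition is_open_interval (U : R -> Prop) : Prop :=
  exists a b : Rbar, forall x : R, U x <-> Rbar_lt a x /\ Rbar_lt x b.

Definition convex_on (U : R -> Prop) (f : R -> R) : Prop :=
  forall x y t : R, U x -> U y -> 0 <= t <= 1 ->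
    f (t * x + (1 - t) * y) <= t * f x + (1 - t) * f y.

(* [is_pseries] asserts that the power series converges at [x - x0] and that
   its sum is [f x], so the radius of convergence is automatically positive. *)
Definition analytic_at (f : R -> R) (x0 : R) : Prop :=
  exists a : nat -> R, locally x0 (fun x : R => is_pseries a (x - x0) (f x)).

(* For open U this depends only on the values of f on U. *)
Definition analytic_on (U : R -> Prop) (f : R -> R) : Prop :=
  forall x0 : R, U x0 -> analytic_at f x0.

(* Main.v *)
Require Import Defs.
From Stdlib Require Import Reals Lra Lia Psatz.
From Stdlib Require Import Classical ClassicalEpsilon.
From Coquelicot Require Import Coquelicot.

Open Scope R_scope.
Set Bullet Behavior "Strict Subproofs".

(** The function f is first replaced by a locally finite sum of kinks, and every
kink is then smoothed separately.  Subtracting a support line at a point p of U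
splits f into a part living on the right of p and a part living on the left of
p; the two are mirror images, so it is enough to treat a convex f >= 0 with
f p = 0 on the right of p ([right_half]).

There f is interpolated at points x_0 = p < x_1 < ... running to the right end
of U and so close to each other that f increases by at most eps between
neighbours, up to a constant factor ([fine_mesh]).  The interpolant is the sum of the kinks
c_i * max (0, x - x_i), where c_i >= 0 is the jump of its slope at x_i.  It is
enough to replace each kink by an analytic convex function whose error is at
most 2^-i / (4 * (1 + c_i)) * eps on the whole of U ([soft_kink]): convexity passes to
the sum of the series because the c_i are nonnegative, and no knowledge of f
beyond the c_i enters.

A soft kink at c is a double primitive of a density
rho x = exp (- (W x + N * (x - c)^2)).  The weight W is analytic and grows so
fast at both ends of U that exp (- W) and its double tails are below eps
([exists_weight]); it is a sum of exponentials with positive coefficients.  The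
Gaussian factor, with N large, makes everything away from c as small as wanted
relative to the total mass of rho.  Since exp (- W) is integrable with its first
moment, a double primitive of rho has an asymptote at each end of U
([right_asymptote], [left_asymptote]); after normalisation the two asymptotes are
0 and x - y, where y is the barycentre of rho.  This y is close to c but not
equal to it, and errors in y would not decay at the ends; a kink at a prescribed
point is obtained as a convex combination of two soft kinks with barycentres on
both sides of it.

Analyticity of infinite sums is controlled without complex analysis by the
norms sum |a_k| r^k of Taylor expansions.  They are submultiplicative, behave
well under infinite sums, exponentials and primitives, and the norm of a soft
kink around a point on its left is small, uniformly in the position of the kink. *)

(** * Taylor expansions with absolutely summable coefficients *)

Lemma choice (A B : Type) (P : A -> B -> Prop) :
  (forall x, exists y, P x y) -> exists f : A -> B, forall x, P x (f x).
Proof.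
  intros H. exists (fun x => proj1_sig (constructive_indefinite_description _ (H x))).
  intros x. apply proj2_sig.
Qed.

Lemma ex_series_dom (a b : nat -> R) :
  (forall n, Rabs (a n) <= b n) -> ex_series b -> ex_series a.
Proof. exact (ex_series_le (K := R_AbsRing) (V := R_CompleteNormedModule) a b). Qed.

Lemma ex_series_cmul (c : R) (a : nat -> R) :
  ex_series a -> ex_series (fun n => c * a n).
Proof. exact (ex_series_scal_l (K := R_AbsRing) (V := R_NormedModule) c a). Qed.

Lemma Series_ge0 (a : nat -> R) :
  (forall n, 0 <= a n) -> ex_series a -> 0 <= Series a.
Proof.
  intros Ha Hs. replace 0 with (Series (fun n => 0 * a n)).
  - apply Series_le; auto. intros n; specialize (Ha n); lra.
  - rewrite Series_scal_l. ring.
Qed.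

(** Dominated convergence for series. *)
Lemma tannery (p : nat -> nat -> R) (l M : nat -> R) :
  (forall i k, Rabs (p i k) <= M i) -> ex_series M ->
  (forall i, is_lim_seq (p i) (l i)) ->
  is_lim_seq (fun k => Series (fun i => p i k)) (Series l).
Proof.
  intros Hp HM Hl.
  assert (HlM : forall i, Rabs (l i) <= M i).
  { intros i.
    apply (is_lim_seq_le (fun k => Rabs (p i k)) (fun _ => M i) (Rabs (l i)) (M i)).
    - intros k; apply Hp.
    - apply (is_lim_seq_abs _ (l i)), Hl.
    - apply is_lim_seq_const. }
  assert (Hpk : forall k, ex_series (fun i => p i k)).
  { intros k; apply (ex_series_dom _ M); auto;
    intros i; apply Hp. }
  assert (Hls : ex_series l).
  { apply (ex_series_dom _ M); auto. }
  assert (HM2 : ex_series (fun i => 2 * M i)) by now apply ex_series_cmul.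
  set (d := fun k i => Rabs (p i k - l i)).
  assert (Hd : forall k i, 0 <= d k i <= 2 * M i).
  { intros k i; split; [apply Rabs_pos|].
    unfold d, Rminus. eapply Rle_trans; [apply Rabs_triang|].
    rewrite Rabs_Ropp. specialize (Hp i k); specialize (HlM i); lra. }
  assert (Hds : forall k, ex_series (d k)).
  { intros k. apply (ex_series_dom _ (fun i => 2 * M i)); auto.
    intros i. change (Rabs (d k i) <= 2 * M i). rewrite Rabs_pos_eq; apply Hd. }
  assert (Hfin : forall n, is_lim_seq (fun k => sum_f_R0 (d k) n) 0).
  { assert (Hd0 : forall i, is_lim_seq (fun k => d k i) 0).
    { intros i. rewrite <- Rabs_R0. apply (is_lim_seq_abs _ 0).
      replace (Finite 0) with (Finite (l i - l i)) by (f_equal; ring).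
      apply is_lim_seq_minus'; [apply Hl | apply is_lim_seq_const]. }
    induction n as [|n IH]; simpl.
    - apply Hd0.
    - replace (Finite 0) with (Finite (0 + 0)) by (f_equal; ring).
      now apply is_lim_seq_plus'. }
  apply is_lim_seq_spec. intros e.
  pose proof (Series_correct _ HM2) as Hc.
  change (is_lim_seq (sum_n (fun i => 2 * M i)) (Series (fun i => 2 * M i))) in Hc.
  apply is_lim_seq_spec in Hc. destruct (Hc (pos_div_2 e)) as [n Hn].
  specialize (Hfin n). apply is_lim_seq_spec in Hfin.
  destruct (Hfin (pos_div_2 e)) as [K HK].
  exists K. intros k Hk. specialize (HK k Hk). specialize (Hn n (le_n n)).
  simpl in HK, Hn.
  rewrite <- Series_minus by auto.
  eapply Rle_lt_trans; [apply Series_Rabs; apply (Hds k)|].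
  change (Series (d k) < e). rewrite (Series_incr_n (d k) (S n)) by (auto; lia).
  rewrite (Series_incr_n (fun i => 2 * M i) (S n)) in Hn by (auto; lia).
  simpl Init.Nat.pred in *.
  rewrite <- sum_n_Reals in Hn.
  assert (Ht : Series (fun j => d k (S n + j)%nat) <= Series (fun j => 2 * M (S n + j)%nat)).
  { apply Series_le; [intros; apply Hd|]. now apply (ex_series_incr_n (fun i => 2 * M i)). }
  rewrite Rminus_0_r in HK. apply Rabs_lt_between in HK.
  apply Rabs_lt_between in Hn.
  lra.
Qed.

(** The functions that admit such an expansion for given x0 and r form a Banach
algebra, and M bounds the norm of f in it.  Keeping the bound explicit is what
allows infinite sums of analytic functions to be taken. *)
Definition expansion (x0 r : R) (f : R -> R) (M : R) : Prop :=
  0 < r /\ exists a : nat -> R,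
    (forall x, Rabs (x - x0) <= r -> f x = PSeries a (x - x0)) /\
    ex_series (fun k => Rabs (a k) * r ^ k) /\
    Series (fun k => Rabs (a k) * r ^ k) <= M.

Lemma pow_abs_le (u r : R) (k : nat) : Rabs u <= r -> Rabs u ^ k <= r ^ k.
Proof. intros H. apply pow_incr. split; [apply Rabs_pos | exact H]. Qed.

Lemma ex_series_abs_dom (a : nat -> R) (r u : R) :
  Rabs u <= r -> ex_series (fun k => Rabs (a k) * r ^ k) ->
  ex_series (fun k => Rabs (a k * u ^ k)).
Proof.
  intros Hu Ha.
  apply ex_series_dom with (2 := Ha).
  intros k. change (Rabs (Rabs (a k * u ^ k)) <= Rabs (a k) * r ^ k).
  rewrite Rabs_Rabsolu, Rabs_mult, <- RPow_abs.
  apply Rmult_le_compat_l; [apply Rabs_pos | now apply pow_abs_le].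
Qed.

Lemma is_series_abs_dom (a : nat -> R) (r u : R) :
  Rabs u <= r -> ex_series (fun k => Rabs (a k) * r ^ k) ->
  is_series (fun k => a k * u ^ k) (PSeries a u).
Proof.
  intros Hu Ha. apply Series_correct, ex_series_Rabs. now apply ex_series_abs_dom with r.
Qed.

Lemma expansion_ext (x0 r : R) (f g : R -> R) (M : R) :
  (forall x, Rabs (x - x0) <= r -> f x = g x) -> expansion x0 r f M -> expansion x0 r g M.
Proof.
  intros H [Hr [a [Ha Hb]]]. split; auto. exists a. split; auto.
  intros x Hx. now rewrite <- H, Ha.
Qed.

Lemma expansion_le (x0 r r' : R) (f : R -> R) (M M' : R) :
  0 < r' <= r -> M <= M' -> expansion x0 r f M -> expansion x0 r' f M'.
Proof.
  intros Hr' HM [Hr [a [Ha [Hb Hc]]]]. split; [lra|]. exists a. split; [|].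
  - intros x Hx; apply Ha; lra.
  - assert (H : forall k, 0 <= Rabs (a k) * r' ^ k <= Rabs (a k) * r ^ k).
    { intros k; split.
      - apply Rmult_le_pos; [apply Rabs_pos | apply pow_le; lra].
      - apply Rmult_le_compat_l; [apply Rabs_pos | apply pow_incr; lra]. }
    split.
    + apply ex_series_dom with (2 := Hb).
      intros k. change (Rabs (Rabs (a k) * r' ^ k) <= Rabs (a k) * r ^ k).
      rewrite Rabs_pos_eq; apply H.
    + eapply Rle_trans; [apply (Series_le _ _ H Hb) | lra].
Qed.

Lemma expansion_ge0 x0 r f M : expansion x0 r f M -> 0 <= M.
Proof.
  intros [Hr [a [Ha [Hb Hc]]]]. eapply Rle_trans; [|apply Hc].
  apply Series_ge0; auto. intros k.
  apply Rmult_le_pos; [apply Rabs_pos | apply pow_le; lra].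
Qed.

Lemma expansion_affine (x0 r c d : R) :
  0 < r -> expansion x0 r (fun x => c + d * (x - x0)) (Rabs c + Rabs d * r).
Proof.
  intros Hr. split; auto.
  set (a := fun k : nat => match k with O => c | S O => d | _ => 0 end).
  assert (H : forall b : nat -> R, (forall k, b (S (S k)) = 0) ->
     is_series b (b O + b 1%nat)).
  { intros b Hb. apply (is_series_decr_n (K := R_AbsRing) (V := R_NormedModule) b 2); [lia|].
    simpl. rewrite sum_Sn, sum_O.
    apply (is_series_ext (fun _ => 0)); [intros; now rewrite Hb|].
    replace (plus _ _) with 0 by (unfold plus, opp; simpl; ring).
    apply filterlim_ext with (fun _ : nat => 0).
    - intros n. rewrite sum_n_const. ring.
    - apply filterlim_const. }
  exists a. split; [|].
  - intros x _. unfold PSeries. symmetry. apply is_series_unique.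
    replace (c + d * (x - x0)) with (a O * (x - x0) ^ 0 + a 1%nat * (x - x0) ^ 1) by (simpl; ring).
    apply (H (fun k => a k * (x - x0) ^ k)). intros; simpl; ring.
  - assert (Hs := H (fun k => Rabs (a k) * r ^ k)
       ltac:(intros; simpl; rewrite Rabs_R0; ring)).
    simpl in Hs. split; [eexists; apply Hs|].
    rewrite (is_series_unique _ _ Hs). lra.
Qed.

Lemma expansion_scal x0 r f M c : expansion x0 r f M -> expansion x0 r (fun x => c * f x) (Rabs c * M).
Proof.
  intros [Hr [a [Ha [Hb Hc]]]]. split; auto. exists (fun k => c * a k).
  split; [|].
  - intros x Hx. rewrite Ha by auto. unfold PSeries.
    rewrite <- Series_scal_l. apply Series_ext. intros; ring.
  - assert (He : forall k, Rabs c * (Rabs (a k) * r ^ k) = Rabs (c * a k) * r ^ k)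
      by (intros; rewrite Rabs_mult; ring).
    split.
    + eapply ex_series_ext; [exact He|]. now apply ex_series_cmul.
    + rewrite <- (Series_ext _ _ He), Series_scal_l.
      apply Rmult_le_compat_l; [apply Rabs_pos | auto].
Qed.

Lemma expansion_plus x0 r f g M N :
  expansion x0 r f M -> expansion x0 r g N -> expansion x0 r (fun x => f x + g x) (M + N).
Proof.
  intros [Hr [a [Ha [Hb Hc]]]] [_ [b [Hd [He Hf]]]]. split; auto.
  exists (fun k => a k + b k).
  assert (Hp : ex_series (fun k => Rabs (a k) * r ^ k + Rabs (b k) * r ^ k))
    by now apply (ex_series_plus (K := R_AbsRing) (V := R_NormedModule) (fun k => Rabs (a k) * r ^ k)).
  assert (Hle : forall k, 0 <= Rabs (a k + b k) * r ^ k <= Rabs (a k) * r ^ k + Rabs (b k) * r ^ k).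
  { intros k. pose proof (pow_le r k ltac:(lra)). split.
    - apply Rmult_le_pos; auto; apply Rabs_pos.
    - rewrite <- Rmult_plus_distr_r. apply Rmult_le_compat_r; auto. apply Rabs_triang. }
  split; [|split].
  - intros x Hx. rewrite Ha, Hd by auto. unfold PSeries. rewrite <- Series_plus.
    + apply Series_ext; intros; ring.
    + eexists; eapply is_series_abs_dom; eauto.
    + eexists; eapply is_series_abs_dom; eauto.
  - apply ex_series_dom with (2 := Hp).
    intros k. change (Rabs (Rabs (a k + b k) * r ^ k) <= Rabs (a k) * r ^ k + Rabs (b k) * r ^ k).
    rewrite Rabs_pos_eq; apply Hle.
  - eapply Rle_trans; [apply (Series_le _ _ Hle Hp)|].
    rewrite Series_plus by auto. lra.
Qed.

Lemma expansion_mult x0 r f g M N :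
  expansion x0 r f M -> expansion x0 r g N -> expansion x0 r (fun x => f x * g x) (M * N).
Proof.
  intros Hf0 Hg0. pose proof (expansion_ge0 _ _ _ _ Hf0). pose proof (expansion_ge0 _ _ _ _ Hg0).
  destruct Hf0 as [Hr [a [Ha [Hb Hc]]]]. destruct Hg0 as [_ [b [Hd [He Hf]]]]. split; auto.
  exists (fun n => sum_f_R0 (fun k => a k * b (n - k)%nat) n).
  assert (Hpow : forall (c d : nat -> R) u n,
    sum_f_R0 (fun k => (c k * u ^ k) * (d (n - k)%nat * u ^ (n - k))) n =
    sum_f_R0 (fun k => c k * d (n - k)%nat) n * u ^ n).
  { intros c d u n. rewrite (Rmult_comm _ (u ^ n)), scal_sum. apply sum_eq.
    intros i Hi. replace (u ^ n) with (u ^ i * u ^ (n - i)); [ring|].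
    rewrite <- pow_add. f_equal. lia. }
  assert (Habs : forall c : nat -> R, ex_series (fun k => Rabs (c k) * r ^ k) ->
     ex_series (fun k => Rabs (Rabs (c k) * r ^ k))).
  { intros c. apply ex_series_ext. intros k. symmetry. apply Rabs_pos_eq.
    apply Rmult_le_pos; [apply Rabs_pos | apply pow_le; lra]. }
  assert (Hab := is_series_mult _ _ _ _ (Series_correct _ Hb) (Series_correct _ He)
     (Habs _ Hb) (Habs _ He)).
  assert (Hab' : is_series (fun n => sum_f_R0 (fun k => Rabs (a k) * Rabs (b (n - k)%nat)) n * r ^ n)
     (Series (fun k => Rabs (a k) * r ^ k) * Series (fun k => Rabs (b k) * r ^ k))).
  { eapply is_series_ext; [|exact Hab]. intros n. simpl.
    exact (Hpow (fun k => Rabs (a k)) (fun k => Rabs (b k)) r n). }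
  assert (Hle : forall n, 0 <= Rabs (sum_f_R0 (fun k => a k * b (n - k)%nat) n) * r ^ n <=
     sum_f_R0 (fun k => Rabs (a k) * Rabs (b (n - k)%nat)) n * r ^ n).
  { intros n. pose proof (pow_le r n ltac:(lra)). split.
    - apply Rmult_le_pos; auto; apply Rabs_pos.
    - apply Rmult_le_compat_r; auto.
      eapply Rle_trans; [apply Rabs_triang_gen|]. right. apply sum_eq. intros; apply Rabs_mult. }
  split; [|split].
  - intros x Hx. rewrite Ha, Hd by auto. symmetry. unfold PSeries at 1.
    apply is_series_unique.
    assert (Hm := is_series_mult _ _ _ _ (is_series_abs_dom a r _ Hx Hb) (is_series_abs_dom b r _ Hx He)
       (ex_series_abs_dom a r _ Hx Hb) (ex_series_abs_dom b r _ Hx He)).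
    eapply is_series_ext; [|exact Hm]. intros n. apply Hpow.
  - apply ex_series_dom with (b := fun n => sum_f_R0 (fun k => Rabs (a k) * Rabs (b (n - k)%nat)) n * r ^ n).
    + intros n.
      change (Rabs (Rabs (sum_f_R0 (fun k => a k * b (n - k)%nat) n) * r ^ n) <= sum_f_R0 (fun k => Rabs (a k) * Rabs (b (n - k)%nat)) n * r ^ n).
      rewrite Rabs_pos_eq; apply Hle.
    + eexists; eauto.
  - eapply Rle_trans; [apply Series_le; [exact Hle | eexists; eauto]|].
    rewrite (is_series_unique _ _ Hab').
    apply Rmult_le_compat; auto.
    + apply (expansion_ge0 x0 r (fun x => PSeries a (x - x0))).
      split; auto. exists a; split; auto. split; auto; lra.
    + apply (expansion_ge0 x0 r (fun x => PSeries b (x - x0))).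
      split; auto. exists b; split; auto. split; auto; lra.
Qed.

(** Completeness of the algebra.  The coefficients are summed termwise; that the
resulting power series has the right sum is an exchange of two summations, done
by [tannery] on the partial sums in the degree. *)
Lemma expansion_series (x0 r : R) (f : nat -> R -> R) (F : R -> R) (M : nat -> R) :
  0 < r -> (forall i, expansion x0 r (f i) (M i)) -> ex_series M ->
  (forall x, Rabs (x - x0) <= r -> F x = Series (fun i => f i x)) ->
  expansion x0 r F (Series M).
Proof.
  intros Hr Hf HM HF. split; auto.
  destruct (choice _ _ (fun i (a : nat -> R) =>
    (forall x, Rabs (x - x0) <= r -> f i x = PSeries a (x - x0)) /\
    ex_series (fun k => Rabs (a k) * r ^ k) /\
    Series (fun k => Rabs (a k) * r ^ k) <= M i)) as [a Ha].
  { intros i; apply (Hf i). }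
  assert (Hpos : forall i k, 0 <= Rabs (a i k) * r ^ k).
  { intros; apply Rmult_le_pos; [apply Rabs_pos | apply pow_le; lra]. }
  assert (Hps : forall i k, sum_n (fun j => Rabs (a i j) * r ^ j) k <= M i).
  { intros i k. destruct (Ha i) as [_ [H1 H2]]. eapply Rle_trans; [|exact H2].
    rewrite (Series_incr_n _ (S k)) by (auto; lia). simpl Init.Nat.pred. rewrite <- sum_n_Reals.
    enough (0 <= Series (fun j => Rabs (a i (S k + j)%nat) * r ^ (S k + j))) by lra.
    apply Series_ge0.
    - intros j. apply Hpos.
    - now apply (ex_series_incr_n (fun j => Rabs (a i j) * r ^ j)). }
  assert (Hterm : forall k, ex_series (fun i => Rabs (a i k) * r ^ k)).
  { intros k. apply ex_series_dom with (2 := HM).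
    intros i. change (Rabs (Rabs (a i k) * r ^ k) <= M i). rewrite Rabs_pos_eq by auto.
    eapply Rle_trans; [|apply (Hps i k)]. destruct k; [rewrite sum_O; lra|].
    rewrite sum_Sn. change (Rabs (a i (S k)) * r ^ S k <= sum_n (fun j => Rabs (a i j) * r ^ j) k + Rabs (a i (S k)) * r ^ S k).
    enough (0 <= sum_n (fun j => Rabs (a i j) * r ^ j) k) by lra.
    rewrite sum_n_Reals. now apply cond_pos_sum. }
  assert (Hswap : forall u : nat -> nat -> R,
    (forall i k, Rabs (u i k) <= Rabs (a i k) * r ^ k) ->
    forall k, sum_n (fun j => Series (fun i => u i j)) k = Series (fun i => sum_n (u i) k)
      /\ ex_series (fun i => sum_n (u i) k)).
  { intros u Hu.
    assert (Hex : forall k, ex_series (fun i => u i k)).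
    { intros k. apply ex_series_dom with (2 := Hterm k).
      intros i. apply Hu. }
    induction k as [|k [IH1 IH2]].
    - rewrite sum_O. split.
      + apply Series_ext. intros i. now rewrite sum_O.
      + apply ex_series_ext with (fun i => u i O); auto. intros i; now rewrite sum_O.
    - assert (He : forall i, sum_n (u i) k + u i (S k) = sum_n (u i) (S k)) by (intros i; now rewrite sum_Sn).
      rewrite sum_Sn, IH1. split.
      + rewrite <- (Series_ext _ _ He), Series_plus by auto. reflexivity.
      + apply (ex_series_ext _ _ He). now apply (ex_series_plus (K := R_AbsRing) (V := R_NormedModule) (fun i => sum_n (u i) k)). }
  exists (fun k => Series (fun i => a i k)).
  split.
  - intros x Hx. rewrite HF by auto. symmetry. unfold PSeries at 1. apply is_series_unique.
    set (u := fun i k => a i k * (x - x0) ^ k).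
    assert (Hu : forall i k, Rabs (u i k) <= Rabs (a i k) * r ^ k).
    { intros i k. unfold u. rewrite Rabs_mult, <- RPow_abs.
      apply Rmult_le_compat_l; [apply Rabs_pos | now apply pow_abs_le]. }
    apply (is_series_ext (fun k => Series (fun i => u i k))).
    { intros k. unfold u. apply Series_scal_r. }
    change (is_lim_seq (sum_n (fun k => Series (fun i => u i k))) (Series (fun i => f i x))).
    apply (is_lim_seq_ext (fun k => Series (fun i => sum_n (u i) k))).
    { intros k. symmetry. apply (Hswap u Hu k). }
    apply (tannery (fun i => sum_n (u i)) _ M).
    + intros i k. eapply Rle_trans; [|apply (Hps i k)].
      rewrite !sum_n_Reals. eapply Rle_trans; [apply Rabs_triang_gen|].
      apply sum_Rle. intros j _. apply Hu.
    + exact HM.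
    + intros i. destruct (Ha i) as [H1 [H2 H3]]. rewrite H1 by auto.
      exact (is_series_abs_dom (a i) r _ Hx H2).
  - assert (HB : forall k, sum_n (fun j => Rabs (Series (fun i => a i j)) * r ^ j) k <= Series M).
    { intros k. set (u := fun i k => Rabs (a i k) * r ^ k).
      assert (Hu : forall i k, Rabs (u i k) <= Rabs (a i k) * r ^ k).
      { intros i j. unfold u. now rewrite Rabs_pos_eq by auto. }
      eapply Rle_trans with (sum_n (fun j => Series (fun i => u i j)) k).
      - rewrite !sum_n_Reals. apply sum_Rle. intros j _. unfold u.
        rewrite Series_scal_r. apply Rmult_le_compat_r; [apply pow_le; lra|].
        apply Series_Rabs.
        assert (Hr' : r ^ j <> 0) by (apply pow_nonzero; lra).
        apply (ex_series_ext (fun i => / r ^ j * (Rabs (a i j) * r ^ j))).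
        + intros i. rewrite (Rmult_comm (Rabs _)), <- Rmult_assoc, Rinv_l, Rmult_1_l by auto. reflexivity.
        + now apply ex_series_cmul.
      - destruct (Hswap u Hu k) as [-> _]. apply Series_le; auto.
        intros i; split; [|apply Hps].
        rewrite sum_n_Reals. apply cond_pos_sum. intros; apply Hpos. }
    assert (Hnn : forall k, 0 <= Rabs (Series (fun i => a i k)) * r ^ k).
    { intros; apply Rmult_le_pos; [apply Rabs_pos | apply pow_le; lra]. }
    destruct (ex_finite_lim_seq_incr (sum_n (fun j => Rabs (Series (fun i => a i j)) * r ^ j)) (Series M)) with (2 := HB) as [l Hl].
    { intros k. rewrite sum_Sn. unfold plus; simpl. specialize (Hnn (S k)). simpl in Hnn. lra. }
    split; [now exists l|]. rewrite (is_series_unique _ l Hl).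
    exact (is_lim_seq_le _ _ l (Series M) HB Hl (is_lim_seq_const _)).
Qed.

Lemma expansion_pow x0 r f M n : expansion x0 r f M -> expansion x0 r (fun x => f x ^ n) (M ^ n).
Proof.
  intros Hf. induction n as [|n IH].
  - apply expansion_ext with (fun x => 1 + 0 * (x - x0)); [intros; simpl; ring|].
    apply expansion_le with r (Rabs 1 + Rabs 0 * r).
    + destruct Hf; lra.
    + rewrite Rabs_R1, Rabs_R0. simpl; lra.
    + apply expansion_affine. now destruct Hf.
  - now apply (expansion_mult x0 r f (fun x => f x ^ n)).
Qed.

(** The exponential series of f converges in norm, because the norm of f^n is at
most M^n. *)
Lemma expansion_exp x0 r f M : expansion x0 r f M -> expansion x0 r (fun x => exp (f x)) (exp M).
Proof.
  intros Hf.
  assert (He : forall y, is_series (fun n => / INR (Factorial.fact n) * y ^ n) (exp y)).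
  { intros y. exact (proj1 (is_pseries_R _ _ _) (is_exp_Reals y)). }
  rewrite <- (is_series_unique _ _ (He M)).
  apply (expansion_series x0 r (fun n x => / INR (Factorial.fact n) * f x ^ n)).
  - now destruct Hf.
  - intros i. pose proof (expansion_scal x0 r _ _ (/ INR (Factorial.fact i)) (expansion_pow x0 r f M i Hf)) as H.
    rewrite Rabs_pos_eq in H; [exact H|].
    left. apply Rinv_0_lt_compat, INR_fact_lt_0.
  - eexists; apply He.
  - intros x _. symmetry. apply is_series_unique, He.
Qed.

Lemma expansion_opp x0 r f M : expansion x0 r f M -> expansion (- x0) r (fun x => f (- x)) M.
Proof.
  intros [Hr [a [Ha Hb]]]. split; auto. exists (fun k => (-1) ^ k * a k). split; [|].
  - intros x Hx. rewrite Ha.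
    + unfold PSeries. apply Series_ext. intros k.
      replace (- x - x0) with ((-1) * (x - - x0)) by ring. rewrite Rpow_mult_distr. ring.
    + replace (- x - x0) with (- (x - - x0)) by ring. now rewrite Rabs_Ropp.
  - assert (He : forall k, Rabs (a k) * r ^ k = Rabs ((-1) ^ k * a k) * r ^ k).
    { intros k. rewrite Rabs_mult, pow_1_abs. ring. }
    split.
    + eapply ex_series_ext; [exact He | apply Hb].
    + rewrite <- (Series_ext _ _ He). apply Hb.
Qed.

Lemma expansion_analytic_at x0 r f M : expansion x0 r f M -> analytic_at f x0.
Proof.
  intros [Hr [a [Ha [Hb _]]]]. exists a. exists (mkposreal r Hr). intros x Hx.
  assert (Hx' : Rabs (x - x0) <= r) by (left; exact Hx).
  rewrite Ha by auto. apply is_pseries_R. now apply is_series_abs_dom with r.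
Qed.

Lemma CV_radius_ge_of_ex_series (a : nat -> R) r :
  ex_series (fun k => Rabs (a k) * r ^ k) -> 0 <= r -> Rbar_le r (CV_radius a).
Proof.
  intros Ha Hr. unfold CV_radius, Lub_Rbar. destruct ex_lub_Rbar as [l [Hl Hl']]; simpl.
  apply Hl. unfold CV_disk. apply ex_series_abs_dom with r; auto. rewrite Rabs_pos_eq; lra.
Qed.

Lemma expansion_derive x0 r f M : expansion x0 r f M -> ex_derive f x0.
Proof.
  intros [Hr [a [Ha [Hb _]]]].
  apply (ex_derive_ext_loc (fun x => PSeries a (x - x0))).
  - exists (mkposreal r Hr). intros x Hx. symmetry. apply Ha. left; exact Hx.
  - eexists. apply (is_derive_comp (PSeries a) (fun x => x - x0)).
    + apply is_derive_PSeries. rewrite Rminus_diag, Rabs_R0.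
      eapply Rbar_lt_le_trans; [|apply CV_radius_ge_of_ex_series; eauto]; simpl; lra.
    + auto_derive; auto.
Qed.

Lemma eq_of_derive_eq (f g : R -> R) (d : R -> R) (x0 r : R) :
  f x0 = g x0 ->
  (forall x, Rabs (x - x0) < r -> is_derive f x (d x)) ->
  (forall x, Rabs (x - x0) < r -> is_derive g x (d x)) ->
  forall x, Rabs (x - x0) < r -> f x = g x.
Proof.
  intros H0 Hf Hg x Hx.
  assert (Hd : forall t, Rabs (t - x0) < r -> is_derive (fun t => f t - g t) t (d t - d t)).
  { intros t Ht. apply (is_derive_minus f g); auto. }
  destruct (MVT_gen (fun t => f t - g t) x0 x (fun t => d t - d t)) as [c [_ Hc]].
  - intros t Ht. apply Hd. apply Rabs_lt_between in Hx. apply Rabs_lt_between.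
    unfold Rmin, Rmax in Ht; destruct (Rle_dec x0 x); lra.
  - intros t Ht. apply continuity_pt_filterlim.
    apply (ex_derive_continuous (K := R_AbsRing) (V := R_NormedModule) (fun t => f t - g t)).
    eexists. apply Hd. apply Rabs_lt_between in Hx. apply Rabs_lt_between.
    unfold Rmin, Rmax in Ht; destruct (Rle_dec x0 x); lra.
  - replace (d c - d c) with 0 in Hc by ring. lra.
Qed.

(** Integration divides the coefficients by integers >= 1, so only the shift by
one degree, a factor r, enters the bound.  The radius shrinks because F is only
known to be a primitive in the open interval. *)
Lemma expansion_prim x0 r r' (F f : R -> R) M :
  0 < r' < r ->
  (forall x, Rabs (x - x0) < r -> is_derive F x (f x)) ->
  expansion x0 r f M -> expansion x0 r' F (Rabs (F x0) + r * M).
Proof.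
  intros Hr' HF [Hr [a [Ha [Hb Hc]]]]. split; [lra|].
  set (c := fun k : nat => match k with O => F x0 | S j => a j / INR (S j) end).
  assert (Hca : forall k, PS_derive c k = a k).
  { intros k. unfold PS_derive, c. field. apply not_0_INR. lia. }
  assert (Hcv : Rbar_le r (CV_radius c)).
  { rewrite <- CV_radius_derive, (CV_radius_ext _ _ Hca). apply CV_radius_ge_of_ex_series; auto; lra. }
  assert (Hlt : forall x, Rabs (x - x0) < r -> Rbar_lt (Rabs (x - x0)) (CV_radius c)).
  { intros x Hx. eapply Rbar_lt_le_trans; [|exact Hcv]. exact Hx. }
  assert (Heq : forall x, Rabs (x - x0) < r -> F x = PSeries c (x - x0)).
  { apply (eq_of_derive_eq F (fun x => PSeries c (x - x0)) f).
    - rewrite Rminus_diag, PSeries_0. reflexivity.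
    - exact HF.
    - intros x Hx. rewrite Ha by lra.
      rewrite <- (PSeries_ext _ _ (x - x0) Hca).
      replace (PSeries (PS_derive c) (x - x0)) with (1 * PSeries (PS_derive c) (x - x0)) by ring.
      apply (is_derive_comp (PSeries c) (fun x => x - x0)).
      + apply is_derive_PSeries, Hlt, Hx.
      + auto_derive; auto. }
  assert (Hle : forall k, 0 <= Rabs (c (S k)) * r' ^ S k <= r * (Rabs (a k) * r ^ k)).
  { intros k. split; [apply Rmult_le_pos; [apply Rabs_pos | apply pow_le; lra]|].
    replace (r * (Rabs (a k) * r ^ k)) with (Rabs (a k) * r ^ S k) by (simpl; ring).
    apply Rmult_le_compat.
    - apply Rabs_pos.
    - apply pow_le; lra.
    - unfold c. unfold Rdiv. rewrite Rabs_mult.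
      rewrite <- (Rmult_1_r (Rabs (a k))) at 2. apply Rmult_le_compat_l; [apply Rabs_pos|].
      assert (1 <= INR (S k)) by (rewrite S_INR; pose proof (pos_INR k); lra).
      rewrite Rabs_pos_eq by (left; apply Rinv_0_lt_compat; lra).
      rewrite <- Rinv_1. apply Rinv_le_contravar; lra.
    - apply pow_incr; lra. }
  assert (Hs : ex_series (fun k => r * (Rabs (a k) * r ^ k))) by now apply ex_series_cmul.
  assert (He : ex_series (fun k => Rabs (c k) * r' ^ k)).
  { apply (ex_series_incr_1 (fun k => Rabs (c k) * r' ^ k)).
    apply ex_series_dom with (2 := Hs). intros k. rewrite Rabs_pos_eq; apply Hle. }
  exists c. split; [|split].
  - intros x Hx. apply Heq. lra.
  - exact He.
  - rewrite (Series_incr_1 _ He).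
    replace (Rabs (c O) * r' ^ 0) with (Rabs (F x0)) by (simpl; ring).
    apply Rplus_le_compat_l.
    eapply Rle_trans; [apply (Series_le _ _ Hle Hs)|].
    rewrite Series_scal_l. apply Rmult_le_compat_l; lra.
Qed.

(** * Open intervals and sequences that exhaust them *)

(** Endpoint-free form of an open interval, which reflection preserves without any
computation with extended reals. *)
Definition open_convex (U : R -> Prop) : Prop :=
  (forall x y z, U x -> U z -> x <= y <= z -> U y) /\
  (forall x, U x -> exists d, 0 < d /\ forall y, Rabs (y - x) <= d -> U y).

(** Replaces positivity and continuity of eps: stable under minima and scaling,
and it yields the uniform lower bounds directly. *)
Definition bounded_below_on_compacts (U : R -> Prop) (eps : R -> R) : Prop :=
  forall a b, U a -> U b -> exists e, 0 < e /\ forall x, a <= x <= b -> e <= eps x.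

Definition expandable_on (U : R -> Prop) (f : R -> R) : Prop :=
  forall x0, U x0 -> exists r M, expansion x0 r f M.

Lemma open_convex_opp U : open_convex U -> open_convex (fun x => U (- x)).
Proof.
  intros [Hc Ho]. split.
  - intros x y z Hx Hz Hy. apply (Hc (- z) (- y) (- x)); auto; lra.
  - intros x Hx. destruct (Ho _ Hx) as [d [Hd H]]. exists d. split; auto.
    intros y Hy. apply H. replace (- y - - x) with (- (y - x)) by ring. now rewrite Rabs_Ropp.
Qed.

Lemma bounded_below_opp U eps :
  bounded_below_on_compacts U eps ->
  bounded_below_on_compacts (fun x => U (- x)) (fun x => eps (- x)).
Proof.
  intros H a b Ha Hb. destruct (H _ _ Hb Ha) as [e [He H']]. exists e. split; auto.
  intros x Hx. apply H'. lra.
Qed.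

Lemma bounded_below_pos U eps :
  bounded_below_on_compacts U eps -> forall x, U x -> 0 < eps x.
Proof.
  intros H x Hx. destruct (H x x Hx Hx) as [e [He He']]. specialize (He' x ltac:(lra)). lra.
Qed.

Lemma expandable_on_opp U f : expandable_on (fun x => U (- x)) f -> expandable_on U (fun x => f (- x)).
Proof.
  intros H x0 Hx0. rewrite <- (Ropp_involutive x0) in Hx0.
  destruct (H _ Hx0) as [r [M HM]]. exists r, M.
  rewrite <- (Ropp_involutive x0). now apply expansion_opp.
Qed.

Lemma expandable_on_plus U f g : expandable_on U f -> expandable_on U g -> expandable_on U (fun x => f x + g x).
Proof.
  intros Hf Hg x Hx. destruct (Hf x Hx) as [r [M H1]]. destruct (Hg x Hx) as [s [N H2]].
  assert (0 < r /\ 0 < s) as [Hr Hs] by (split; [apply H1 | apply H2]).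
  assert (0 < Rmin r s) by now apply Rmin_glb_lt.
  exists (Rmin r s), (M + N). apply expansion_plus.
  - apply expansion_le with r M; auto; [|lra]. split; auto; apply Rmin_l.
  - apply expansion_le with s N; auto; [|lra]. split; auto; apply Rmin_r.
Qed.

(** Greedy construction: each step is at least half as long as the longest
admissible one.  If the sequence had a supremum L in U, the steps near L would
have a length bounded from below, and the sequence would pass L. *)
Lemma exhausting_sequence U (P : R -> R -> Prop) p :
  open_convex U -> U p ->
  (forall L, U L -> exists d, 0 < d /\
     forall x y, L - d < x -> x < y -> y < L + d -> P x y) ->
  exists xs : nat -> R, xs O = p /\
    (forall n, U (xs n) /\ xs n < xs (S n) /\ P (xs n) (xs (S n))) /\
    (forall z, U z -> exists n, z < xs n).
Proof.
  intros [Hc Ho] Hp HP.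
  set (E := fun x s => 0 < s <= 1 /\ forall y, x < y <= x + s -> U y /\ P x y).
  assert (HE : forall L, U L -> exists d, 0 < d /\ forall x, L - d < x <= L -> E x d).
  { intros L HL. destruct (Ho L HL) as [d1 [Hd1 H1]]. destruct (HP L HL) as [d2 [Hd2 H2]].
    assert (H : 0 < Rmin (Rmin d1 d2) 1) by (repeat apply Rmin_glb_lt; lra).
    pose proof (Rmin_l (Rmin d1 d2) 1). pose proof (Rmin_r (Rmin d1 d2) 1).
    pose proof (Rmin_l d1 d2). pose proof (Rmin_r d1 d2).
    exists (Rmin (Rmin d1 d2) 1 / 2). split; [lra|].
    intros x Hx. split; [lra|]. intros y Hy. split.
    - apply H1. apply Rabs_le. lra.
    - apply H2; lra. }
  assert (Hst : forall x, exists s, U x -> E x s /\ forall s', E x s' -> s' <= 2 * s).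
  { intros x. destruct (classic (U x)) as [Hx|Hx]; [|exists 0; tauto].
    destruct (HE x Hx) as [d [Hd HEd]].
    assert (HEx : E x d) by (apply HEd; lra).
    destruct (completeness (E x)) as [m [Hm1 Hm2]].
    - exists 1. intros s [Hs _]. lra.
    - now exists d.
    - assert (0 < m) by (specialize (Hm1 d HEx); lra).
      destruct (classic (exists s, E x s /\ m / 2 < s)) as [[s [Hs1 Hs2]]|Hn].
      + exists s. intros _. split; auto. intros s' Hs'. specialize (Hm1 s' Hs'). lra.
      + exfalso. enough (m <= m / 2) by lra. apply Hm2. intros s Hs.
        apply Rnot_lt_le. intros Hlt. apply Hn. now exists s. }
  apply choice in Hst. destruct Hst as [st Hst].
  set (xs := fix xs n := match n with O => p | S m => xs m + st (xs m) end).
  assert (HU : forall n, U (xs n)).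
  { induction n as [|n IH]; simpl; auto. destruct (Hst _ IH) as [[H1 H2] _].
    apply H2. lra. }
  exists xs. split; [reflexivity|]. split.
  - intros n. destruct (Hst _ (HU n)) as [[H1 H2] _]. simpl. split; [|split].
    + apply HU.
    + lra.
    + apply H2. lra.
  - intros z Hz. apply NNPP. intros Hn.
    assert (Hub : forall n, xs n <= z).
    { intros n. apply Rnot_lt_le. intros Hlt. apply Hn. now exists n. }
    destruct (completeness (fun y => exists n, y = xs n)) as [L [HL1 HL2]].
    { exists z. intros y [n ->]. apply Hub. }
    { exists p, O. reflexivity. }
    assert (HL1' : forall n, xs n <= L) by (intros n; apply HL1; now exists n).
    assert (HUL : U L).
    { apply (Hc p L z); auto. split; [apply (HL1' O)|]. apply HL2. intros y [n ->]; auto. }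
    destruct (HE L HUL) as [d [Hd Hd']].
    assert (Hx : exists n, L - d / 2 < xs n).
    { apply NNPP. intros Hno. enough (L <= L - d / 2) by lra. apply HL2. intros y [n ->].
      apply Rnot_lt_le. intros Hlt. apply Hno. now exists n. }
    destruct Hx as [n Hn'].
    pose proof (HL1' n). pose proof (HL1' (S n)) as HSn. simpl in HSn.
    destruct (Hst _ (HU n)) as [_ H2].
    specialize (H2 d (Hd' (xs n) ltac:(lra))). lra.
Qed.

Lemma increasing_le (xs : nat -> R) :
  (forall n, xs n < xs (S n)) -> forall m n, (m <= n)%nat -> xs m <= xs n.
Proof.
  intros H m n Hmn. induction Hmn; [lra|]. specialize (H m0). lra.
Qed.

Lemma bracket (xs : nat -> R) t n : xs O <= t < xs n -> exists k, xs k <= t < xs (S k).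
Proof.
  induction n as [|n IH]; intros [H1 H2]; [lra|].
  destruct (Rle_dec (xs n) t) as [H|H]; [now exists n|]. apply IH; lra.
Qed.

Lemma Series_ge_term (a : nat -> R) n :
  (forall k, 0 <= a k) -> ex_series a -> a n <= Series a.
Proof.
  intros Ha Hs. rewrite (Series_incr_n a (S n)) by (auto; lia). simpl Init.Nat.pred.
  assert (0 <= Series (fun k => a (S n + k)%nat)).
  { apply Series_ge0; auto. now apply (ex_series_incr_n a). }
  assert (a n <= sum_f_R0 a n).
  { destruct n; simpl; [lra|]. pose proof (cond_pos_sum a n Ha). lra. }
  lra.
Qed.

Lemma exp_le_1 x : x <= 0 -> exp x <= 1.
Proof.
  intros H. rewrite <- exp_0. destruct H as [H| ->]; [left; now apply exp_increasing | lra].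
Qed.

Lemma exp_le x y : x <= y -> exp x <= exp y.
Proof. intros [H| ->]; [left; now apply exp_increasing | lra]. Qed.

Lemma exp_decay B d e : 0 <= B -> 0 < d -> 0 < e ->
  exists N, 0 < N /\ forall N', N <= N' -> B * exp (- (N' * d)) <= e.
Proof.
  intros HB Hd He. exists ((B + 1) / (d * e)). split.
  { apply Rdiv_lt_0_compat; [lra | now apply Rmult_lt_0_compat]. }
  intros N' HN'.
  assert (H1 : B + 1 <= N' * d * e).
  { apply Rmult_le_compat_r with (r := d * e) in HN'; [|nra].
    unfold Rdiv in HN'. rewrite Rmult_assoc, Rinv_l in HN' by nra. lra. }
  rewrite exp_Ropp.
  pose proof (exp_ineq1_le (N' * d)). pose proof (exp_pos (N' * d)).
  apply Rmult_le_reg_r with (exp (N' * d)); auto.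
  rewrite Rmult_assoc, Rinv_l by lra. nra.
Qed.

(** * An analytic weight that grows fast at both ends *)

(** V is the sum of B_n * exp (mu_n * (x - x_n)), where B_n is a bound required on
[x_n, x_(n+1)] and x_n runs to the right end.  On that interval the n-th term
alone is at least B_n, and a large mu_n makes it smaller than a geometric term
on the left of x_(n-1).  The Taylor coefficients of every term are positive, so
the norm around x0 with radius r is the value of the series at x0 + r. *)
Lemma right_weight U eps p :
  open_convex U -> U p -> bounded_below_on_compacts U eps ->
  exists V, expandable_on U V /\ (forall x, U x -> 0 <= V x) /\
    (forall x t, U t -> p <= x <= t -> exp (- V t) <= eps x * exp (- (t - x))).
Proof.
  intros HU Hp Heps.
  destruct (exhausting_sequence U (fun _ _ => True) p HU Hp) as [xs [H0 [Hxs Hex]]].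
  { intros L _. exists 1. split; [lra | auto]. }
  assert (Hinc : forall n, xs n < xs (S n)) by (intros; apply Hxs).
  assert (HB : forall n, exists B, 0 <= B /\ forall x t, p <= x -> x <= t -> t <= xs (S n) ->
     exp (- B) <= eps x * exp (- (t - x))).
  { intros n. destruct (Heps p (xs (S n))) as [e [He He']]; auto; [apply Hxs|].
    exists (Rabs (ln e) + Rabs (xs (S n) - p)). split.
    - pose proof (Rabs_pos (ln e)); pose proof (Rabs_pos (xs (S n) - p)); lra.
    - intros x t H1 H2 H3. apply Rle_trans with (e * exp (- (t - x))).
      + rewrite <- (exp_ln e) at 2 by auto. rewrite <- exp_plus. apply exp_le.
        pose proof (Rle_abs (- ln e)) as Ha. rewrite Rabs_Ropp in Ha.
        pose proof (Rle_abs (xs (S n) - p)). lra.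
      + apply Rmult_le_compat_r; [left; apply exp_pos|]. apply He'. lra. }
  apply choice in HB. destruct HB as [B HB].
  assert (Hmu : forall n, exists mu, 0 <= mu /\
     B (S n) * exp (- (mu * (xs (S n) - xs n))) <= (1/2) ^ n).
  { intros n. destruct (exp_decay (B (S n)) (xs (S n) - xs n) ((1/2)^n)) as [mu [Hmu H]].
    - apply HB.
    - specialize (Hinc n); lra.
    - apply pow_lt; lra.
    - exists mu. split; [lra|]. apply H; lra. }
  apply choice in Hmu. destruct Hmu as [mu' Hmu].
  (* The term of index 0 has no point before x_0 to be small at, and may be constant. *)
  set (mu := fun n => match n with O => 0 | S n => mu' n end).
  assert (Hmu0 : forall n, 0 <= mu n) by (intros [|n]; simpl; [lra | apply Hmu]).
  set (T := fun n x => B n * exp (mu n * (x - xs n))).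
  assert (HT0 : forall n x, 0 <= T n x).
  { intros n x. apply Rmult_le_pos; [apply HB | left; apply exp_pos]. }
  assert (Hmono : forall n x y, x <= y -> T n x <= T n y).
  { intros n x y Hxy. apply Rmult_le_compat_l; [apply HB|]. apply exp_le.
    apply Rmult_le_compat_l; auto; lra. }
  assert (Hsum : forall x k, x <= xs k -> ex_series (fun n => T n x)).
  { intros x k Hx. apply (ex_series_incr_n (fun n => T n x) (S k)).
    apply ex_series_dom with (fun n => (1/2) ^ k * (1/2) ^ n).
    - intros n. rewrite Rabs_pos_eq by auto. rewrite <- pow_add.
      eapply Rle_trans; [|apply (Hmu (k + n)%nat)]. unfold T. simpl.
      apply Rmult_le_compat_l; [apply HB|]. apply exp_le.
      rewrite Ropp_mult_distr_r.
      apply Rmult_le_compat_l; [apply Hmu|].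
      pose proof (increasing_le xs Hinc k (k + n) ltac:(lia)). lra.
    - apply ex_series_cmul. apply ex_series_geom. rewrite Rabs_pos_eq; lra. }
  exists (fun x => Series (fun n => T n x)). split; [|split].
  - intros x0 Hx0. destruct (Hex x0 Hx0) as [k Hk].
    exists (xs k - x0), (Series (fun n => T n (xs k))).
    apply (expansion_series x0 (xs k - x0) T); [lra | | apply (Hsum _ k); lra | reflexivity].
    intros n.
    apply expansion_ext with (fun x => B n * exp (mu n * (x0 - xs n)) * exp (0 + mu n * (x - x0))).
    { intros x _. unfold T. rewrite Rmult_assoc, <- exp_plus. do 2 f_equal. ring. }
    assert (Hr : 0 < xs k - x0) by lra.
    pose proof (expansion_scal _ _ _ _ (B n * exp (mu n * (x0 - xs n)))
      (expansion_exp _ _ _ _ (expansion_affine x0 (xs k - x0) 0 (mu n) Hr))) as HA.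
    refine (expansion_le _ _ _ _ _ _ (conj Hr (Rle_refl _)) _ HA).
    unfold T. rewrite Rabs_R0, (Rabs_pos_eq (mu n)) by auto.
    rewrite Rabs_pos_eq.
    + rewrite Rmult_assoc, <- exp_plus. right. do 2 f_equal. ring.
    + apply Rmult_le_pos; [apply HB | left; apply exp_pos].
  - intros x Hx. destruct (Hex x Hx) as [k Hk]. apply Series_ge0; auto. apply (Hsum _ k); lra.
  - intros x t Ht Hxt. destruct (Hex t Ht) as [m Hm].
    destruct (bracket xs t m ltac:(lra)) as [n Hn].
    destruct (HB n) as [HB1 HB2].
    eapply Rle_trans; [|apply (HB2 x t); lra]. apply exp_le, Ropp_le_contravar.
    eapply Rle_trans; [|apply (Series_ge_term _ n); auto; apply (Hsum _ m); lra].
    unfold T. rewrite <- (Rmult_1_r (B n)) at 1. apply Rmult_le_compat_l; auto.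
    rewrite <- exp_0. apply exp_le. apply Rmult_le_pos; auto; lra.
Qed.

(** The decay does not depend on the base point, up to a constant: between c and p
everything is compared with the minimum of eps there. *)
Lemma right_weight_decays U eps p V c :
  U p -> U c -> bounded_below_on_compacts U eps ->
  (forall x, U x -> 0 <= V x) ->
  (forall x t, U t -> p <= x <= t -> exp (- V t) <= eps x * exp (- (t - x))) ->
  exists C, 0 < C /\ forall x t, U x -> U t -> c <= x <= t ->
    exp (- V t) <= C * eps x * exp (- (t - x)).
Proof.
  intros Hp Hc Heps HV0 HV. destruct (Heps c p Hc Hp) as [e [He Hee]].
  pose proof (bounded_below_pos U eps Heps) as Hepos.
  pose proof (Hepos p Hp) as Hep. pose proof (exp_pos (p - c)) as Hex.
  set (C1 := (1 + eps p) * exp (p - c) / e).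
  assert (HC1 : 0 < C1) by (unfold C1; apply Rdiv_lt_0_compat; auto; nra).
  exists (1 + C1). split; [lra|]. intros x t Hx Ht Hxt.
  pose proof (Hepos x Hx) as Hex'. pose proof (exp_pos (- (t - x))) as Het.
  destruct (Rle_dec p x) as [Hpx|Hpx].
  - eapply Rle_trans; [apply (HV x t); auto; lra|].
    apply Rmult_le_compat_r; [lra|]. nra.
  - assert (H1 : (1 + eps p) * exp (p - c) <= C1 * eps x).
    { replace ((1 + eps p) * exp (p - c)) with (C1 * e) by (unfold C1; field; lra).
      apply Rmult_le_compat_l; [lra|]. apply Hee. lra. }
    apply Rle_trans with ((1 + eps p) * exp (p - c) * exp (- (t - x))).
    2:{ apply Rmult_le_compat_r; [lra|]. nra. }
    rewrite Rmult_assoc, <- exp_plus.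
    destruct (Rle_dec p t) as [Hpt|Hpt].
    + eapply Rle_trans; [apply (HV p t); auto; lra|].
      apply Rmult_le_compat; [lra | left; apply exp_pos | lra |]. apply exp_le. lra.
    + apply Rle_trans with 1; [apply exp_le_1; specialize (HV0 t Ht); lra|].
      rewrite <- (Rmult_1_r 1) at 1. apply Rmult_le_compat; try lra.
      rewrite <- exp_0. apply exp_le. lra.
Qed.

(** The factor exp (- |t - x|) makes both the tail integral and the double tail
integral of exp (- W) beyond x at most C * eps x. *)
Definition decays_from (U : R -> Prop) (eps W : R -> R) (c : R) : Prop :=
  exists C, 0 < C /\ forall x t, U x -> U t -> c <= x <= t \/ t <= x <= c ->
    exp (- W t) <= C * eps x * exp (- Rabs (t - x)).

Lemma exists_weight U eps :
  open_convex U -> bounded_below_on_compacts U eps -> (exists p, U p) ->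
  exists W, expandable_on U W /\ (forall x, U x -> 0 <= W x) /\
    forall c, U c -> decays_from U eps W c.
Proof.
  intros HU Heps [p Hp].
  destruct (right_weight U eps p) as [V [HV1 [HV2 HV3]]]; auto.
  destruct (right_weight (fun x => U (- x)) (fun x => eps (- x)) (- p)) as [V' [HV1' [HV2' HV3']]].
  { now apply open_convex_opp. }
  { now rewrite Ropp_involutive. }
  { now apply bounded_below_opp. }
  assert (HV2'' : forall x, U x -> 0 <= V' (- x)).
  { intros x Hx. apply HV2'. now rewrite Ropp_involutive. }
  exists (fun x => V x + V' (- x)). split; [|split].
  - apply expandable_on_plus; auto. now apply (expandable_on_opp U V').
  - intros x Hx. specialize (HV2 x Hx). specialize (HV2'' x Hx). lra.
  - intros c Hc.
    destruct (right_weight_decays U eps p V c) as [C [HC1 HC2]]; auto.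
    destruct (right_weight_decays (fun x => U (- x)) (fun x => eps (- x)) (- p) V' (- c))
      as [C' [HC1' HC2']]; auto; try (now rewrite Ropp_involutive).
    { now apply bounded_below_opp. }
    pose proof (bounded_below_pos U eps Heps) as Hepos.
    exists (C + C'). split; [lra|]. intros x t Hx Ht Hxt.
    specialize (Hepos x Hx). specialize (HV2 t Ht). specialize (HV2'' t Ht).
    destruct Hxt as [Hxt|Hxt].
    + rewrite Rabs_pos_eq by lra. pose proof (exp_pos (- (t - x))).
      apply Rle_trans with (exp (- V t)); [apply exp_le; lra|].
      eapply Rle_trans; [apply (HC2 x t); auto|]. apply Rmult_le_compat_r; nra.
    + rewrite Rabs_left1 by lra. pose proof (exp_pos (- - (t - x))).
      apply Rle_trans with (exp (- V' (- t))); [apply exp_le; lra|].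
      eapply Rle_trans; [apply (HC2' (- x) (- t)); rewrite ?Ropp_involutive; auto; lra|].
      rewrite Ropp_involutive. replace (- t - - x) with (- (t - x)) by ring.
      apply Rmult_le_compat_r; nra.
Qed.

(** * Convex functions given by their second derivative *)

Lemma is_derive_continuity_pt (f : R -> R) x l : is_derive f x l -> continuity_pt f x.
Proof.
  intros H. apply continuity_pt_filterlim.
  apply (ex_derive_continuous (K := R_AbsRing) (V := R_NormedModule) f). now exists l.
Qed.

Lemma mvt_on U (f df : R -> R) a b :
  open_convex U -> U a -> U b -> (forall x, U x -> is_derive f x (df x)) ->
  exists c, U c /\ Rmin a b <= c <= Rmax a b /\ f b - f a = df c * (b - a).
Proof.
  intros [HU _] Ha Hb Hf.
  assert (H : forall x, Rmin a b <= x <= Rmax a b -> U x).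
  { intros x Hx. unfold Rmin, Rmax in Hx. destruct (Rle_dec a b).
    - now apply (HU a x b).
    - now apply (HU b x a). }
  destruct (MVT_gen f a b df) as [c [Hc He]].
  - intros x Hx. apply Hf, H. lra.
  - intros x Hx. apply is_derive_continuity_pt with (df x). now apply Hf, H.
  - exists c. auto.
Qed.

Definition nonneg_second_derivative (U : R -> Prop) (Phi F rho : R -> R) : Prop :=
  forall x, U x -> is_derive Phi x (F x) /\ is_derive F x (rho x) /\ 0 <= rho x.

Lemma slope_increasing U Phi F rho x y :
  open_convex U -> nonneg_second_derivative U Phi F rho ->
  U x -> U y -> x <= y -> F x <= F y.
Proof.
  intros HU HD Hx Hy Hxy. destruct (mvt_on U F rho x y) as [c [Hc [_ He]]]; auto.
  { intros z Hz; apply (HD z Hz). }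
  destruct (HD c Hc) as [_ [_ Hrho]]. nra.
Qed.

Lemma above_tangent U Phi F rho x z :
  open_convex U -> nonneg_second_derivative U Phi F rho ->
  U x -> U z -> Phi z + F z * (x - z) <= Phi x.
Proof.
  intros HU HD Hx Hz. destruct (mvt_on U Phi F z x) as [c [Hc [Hzx He]]]; auto.
  { intros y Hy; apply (HD y Hy). }
  unfold Rmin, Rmax in Hzx. destruct (Rle_dec z x).
  - pose proof (slope_increasing U Phi F rho z c HU HD Hz Hc ltac:(lra)). nra.
  - pose proof (slope_increasing U Phi F rho c z HU HD Hc Hz ltac:(lra)). nra.
Qed.

Lemma convex_of_second_derivative U Phi F rho :
  open_convex U -> nonneg_second_derivative U Phi F rho ->
  convex_on U Phi.
Proof.
  intros HU HD x y t Hx Hy Ht. set (z := t * x + (1 - t) * y).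
  assert (Hz : U z).
  { unfold z. destruct (Rle_dec x y).
    - apply (proj1 HU x _ y); auto. nra.
    - apply (proj1 HU y _ x); auto. nra. }
  pose proof (above_tangent U Phi F rho x z HU HD Hx Hz).
  pose proof (above_tangent U Phi F rho y z HU HD Hy Hz).
  assert (t * (Phi z + F z * (x - z)) <= t * Phi x) by (apply Rmult_le_compat_l; lra).
  assert ((1 - t) * (Phi z + F z * (y - z)) <= (1 - t) * Phi y) by (apply Rmult_le_compat_l; lra).
  assert (t * (x - z) + (1 - t) * (y - z) = 0) by (unfold z; ring).
  nra.
Qed.

(** The second quantity is the integral of (t - x) * rho t over [x, z], that is,
the height of Phi above its tangent at z.  Both bounds compare with the explicit
primitives of exp (- (t - x)) and (t - x) * exp (- (t - x)). *)
Lemma tail_bound U Phi F rho x z T :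
  open_convex U -> nonneg_second_derivative U Phi F rho ->
  U x -> U z -> x <= z ->
  (forall t, U t -> x <= t -> rho t <= T * exp (- (t - x))) ->
  F z - F x <= T /\ Phi x - Phi z + F z * (z - x) <= T.
Proof.
  intros HU HD Hx Hz Hxz HT.
  assert (HPhi : forall x, U x -> is_derive Phi x (F x)) by (intros; now apply HD).
  assert (HF : forall x, U x -> is_derive F x (rho x)) by (intros; now apply HD).
  assert (Hrho : forall x, U x -> 0 <= rho x) by (intros; now apply HD).
  assert (HT0 : 0 <= T).
  { specialize (HT x Hx (Rle_refl x)). rewrite Rminus_diag, Ropp_0, exp_0 in HT.
    specialize (Hrho x Hx). lra. }
  split.
  - destruct (MVT_gen (fun t => - T * exp (- (t - x)) - F t) x z
       (fun t => T * exp (- (t - x)) - rho t)) as [c [Hc He]].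
    + intros t Ht. assert (U t).
      { apply (proj1 HU x t z); auto. rewrite Rmin_left, Rmax_right in Ht by lra. lra. }
      apply (is_derive_minus (K := R_AbsRing) (V := R_NormedModule) (fun t => - T * exp (- (t - x))) F); auto.
      auto_derive; auto. unfold Rminus; ring.
    + intros t Ht. assert (U t).
      { apply (proj1 HU x t z); auto. rewrite Rmin_left, Rmax_right in Ht by lra. lra. }
      apply (is_derive_continuity_pt _ _ (T * exp (- (t - x)) - rho t)).
      apply (is_derive_minus (K := R_AbsRing) (V := R_NormedModule) (fun t => - T * exp (- (t - x))) F); auto.
      auto_derive; auto. unfold Rminus; ring.
    + rewrite Rmin_left, Rmax_right in Hc by lra.
      assert (U c) by (apply (proj1 HU x c z); auto).
      specialize (HT c H ltac:(lra)). rewrite Rminus_diag, Ropp_0, exp_0 in He.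
      pose proof (exp_pos (- (z - x))). nra.
  - assert (Hd : forall t, U t -> is_derive
      (fun t => - T * ((1 + (t - x)) * exp (- (t - x))) + Phi t - F t * (t - x)) t
      ((t - x) * (T * exp (- (t - x)) - rho t))).
    { intros t Ht.
      replace ((t - x) * (T * exp (- (t - x)) - rho t)) with
        (T * (t - x) * exp (- (t - x)) + F t - (rho t * (t - x) + F t * 1)) by ring.
      apply (is_derive_minus (K := R_AbsRing) (V := R_NormedModule)
        (fun t => - T * ((1 + (t - x)) * exp (- (t - x))) + Phi t) (fun t => F t * (t - x))).
      - apply (is_derive_plus (K := R_AbsRing) (V := R_NormedModule)
          (fun t => - T * ((1 + (t - x)) * exp (- (t - x)))) Phi); auto.
        auto_derive; auto. unfold Rminus; ring.
      - apply (is_derive_mult F (fun t => t - x)); auto.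
        + auto_derive; auto.
        + intros; apply Rmult_comm. }
    destruct (mvt_on U _ _ x z HU Hx Hz Hd) as [c [Hc [Hcb He]]].
    rewrite Rmin_left, Rmax_right in Hcb by lra.
    specialize (HT c Hc ltac:(lra)).
    rewrite Rminus_diag, Ropp_0, exp_0 in He.
    assert (0 <= (c - x) * (T * exp (- (c - x)) - rho c) * (z - x)).
    { repeat apply Rmult_le_pos; lra. }
    assert (0 <= T * ((1 + (z - x)) * exp (- (z - x)))).
    { repeat apply Rmult_le_pos; try lra. left; apply exp_pos. }
    lra.
Qed.

(** The asymptote is the limit of the tangents at points z running to the right
end.  Their slopes increase and their values at c decrease, and [tail_bound]
bounds both. *)
Lemma right_asymptote U Phi F rho c T :
  open_convex U -> nonneg_second_derivative U Phi F rho ->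
  U c ->
  (forall x t, U x -> U t -> c <= x -> x <= t -> rho t <= T x * exp (- (t - x))) ->
  exists P Q, (forall x, U x -> F x <= P) /\
    (forall x, U x -> P * (x - c) - Q <= Phi x) /\
    (forall x, U x -> c <= x -> Phi x <= P * (x - c) - Q + T x).
Proof.
  intros HU HD2 Hc HT.
  destruct (exhausting_sequence U (fun _ _ => True) c HU Hc) as [xs [H0 [Hxs Hex]]].
  { intros L _. exists 1. split; [lra | auto]. }
  assert (Hinc : forall n, xs n < xs (S n)) by (intros; apply Hxs).
  assert (HUx : forall n, U (xs n)) by (intros; apply Hxs).
  assert (Hcx : forall n, c <= xs n).
  { intros n. rewrite <- H0. apply increasing_le; auto. lia. }
  assert (HFn : forall n, F (xs n) <= F (xs (S n))).
  { intros n. apply (slope_increasing U Phi F rho); auto. specialize (Hinc n); lra. }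
  assert (HD : forall x n, U x -> c <= x -> x <= xs n ->
    F (xs n) - F x <= T x /\ Phi x - Phi (xs n) + F (xs n) * (xs n - x) <= T x).
  { intros x n Hx Hcx' Hxn. apply (tail_bound U Phi F rho); auto. }
  set (G := fun n => F (xs n) * (xs n - c) - Phi (xs n)).
  destruct (ex_finite_lim_seq_incr (fun n => F (xs n)) (F c + T c)) as [P HP]; auto.
  { intros n. destruct (HD c n Hc ltac:(lra) (Hcx n)). lra. }
  destruct (ex_finite_lim_seq_incr G (T c - Phi c)) as [Q HQ].
  { intros n. unfold G. pose proof (above_tangent U Phi F rho (xs n) (xs (S n)) HU HD2 (HUx _) (HUx _)).
    specialize (HFn n). specialize (Hcx n). nra. }
  { intros n. unfold G. destruct (HD c n Hc ltac:(lra) (Hcx n)). lra. }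
  assert (Hev : forall x, U x -> eventually (fun n => x <= xs n)).
  { intros x Hx. destruct (Hex x Hx) as [n Hn]. exists n. intros m Hm.
    pose proof (increasing_le xs Hinc n m Hm). lra. }
  assert (HL : forall x, is_lim_seq (fun n => F (xs n) * (x - c) - G n) (P * (x - c) - Q)).
  { intros x. apply is_lim_seq_minus'; auto.
    exact (is_lim_seq_scal_r _ (x - c) P HP). }
  exists P, Q. split; [|split].
  - intros x Hx. apply (is_lim_seq_le_loc (fun _ => F x) (fun n => F (xs n)) (F x) P); auto.
    + destruct (Hev x Hx) as [n Hn]. exists n. intros m Hm. apply (slope_increasing U Phi F rho); auto.
    + apply is_lim_seq_const.
  - intros x Hx. apply (is_lim_seq_le _ (fun _ => Phi x) (P * (x - c) - Q) (Phi x)) with (2 := HL x).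
    + intros n. unfold G. pose proof (above_tangent U Phi F rho x (xs n) HU HD2 Hx (HUx n)). lra.
    + apply is_lim_seq_const.
  - intros x Hx Hcx'.
    apply (is_lim_seq_le_loc (fun _ => Phi x) (fun n => (F (xs n) * (x - c) - G n) + T x) (Phi x) (P * (x - c) - Q + T x)).
    + destruct (Hev x Hx) as [n Hn]. exists n. intros m Hm.
      destruct (HD x m Hx Hcx' (Hn m Hm)) as [_ H]. unfold G. lra.
    + apply is_lim_seq_const.
    + apply is_lim_seq_plus'; auto. apply is_lim_seq_const.
Qed.

Lemma left_asymptote U Phi F rho c T :
  open_convex U -> nonneg_second_derivative U Phi F rho -> U c ->
  (forall x t, U x -> U t -> x <= c -> t <= x -> rho t <= T x * exp (- (x - t))) ->
  exists P Q, (forall x, U x -> - P <= F x) /\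
    (forall x, U x -> - (P * (x - c)) - Q <= Phi x) /\
    (forall x, U x -> x <= c -> Phi x <= - (P * (x - c)) - Q + T x).
Proof.
  intros HU HD Hc HT.
  destruct (right_asymptote (fun x => U (- x)) (fun x => Phi (- x)) (fun x => - F (- x))
    (fun x => rho (- x)) (- c) (fun x => T (- x))) as [P [Q [H1 [H2 H3]]]].
  { now apply open_convex_opp. }
  { intros x Hx. destruct (HD _ Hx) as [D1 [D2 D3]]. split; [|split]; auto.
    - replace (- F (- x)) with (-1 * F (- x)) by ring.
      apply (is_derive_comp Phi (fun x => - x)); auto. auto_derive; auto; try ring.
    - replace (rho (- x)) with (- (-1 * rho (- x))) by ring.
      apply (is_derive_opp (fun x => F (- x))).
      apply (is_derive_comp F (fun x => - x)); auto. auto_derive; auto; try ring. }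
  { now rewrite Ropp_involutive. }
  { intros x t Hx Ht Hx1 Ht1. replace (t - x) with (- x - - t) by ring. apply HT; auto; lra. }
  exists P, Q. split; [|split]; intros x Hx.
  - specialize (H1 (- x)). rewrite Ropp_involutive in H1. specialize (H1 Hx). lra.
  - specialize (H2 (- x)). rewrite Ropp_involutive in H2. specialize (H2 Hx). lra.
  - intros Hxc. specialize (H3 (- x)). rewrite Ropp_involutive in H3. specialize (H3 Hx). lra.
Qed.

Lemma primitive_on U c (f : R -> R) : open_convex U -> U c ->
  (forall x, U x -> continuous f x) ->
  exists F, F c = 0 /\ forall x, U x -> is_derive F x (f x).
Proof.
  intros HU Hc Hf. exists (fun x => RInt f c x). split; [exact (RInt_point c f)|].
  intros x Hx. apply (is_derive_RInt f _ c x); auto.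
  destruct (proj2 HU x Hx) as [d [Hd H]]. exists (mkposreal d Hd).
  intros y Hy. assert (HUy : U y) by (apply H; left; exact Hy).
  apply (RInt_correct (V := R_CompleteNormedModule)).
  apply (ex_RInt_continuous (V := R_CompleteNormedModule)).
  intros z Hz. apply Hf. unfold Rmin, Rmax in Hz. destruct (Rle_dec c y).
  - now apply (proj1 HU c z y).
  - now apply (proj1 HU y z c).
Qed.

Lemma expandable_on_continuous U f x : expandable_on U f -> U x -> continuous f x.
Proof.
  intros H Hx. destruct (H x Hx) as [r [M HM]].
  apply (ex_derive_continuous (K := R_AbsRing) (V := R_NormedModule) f).
  now apply expansion_derive with r M.
Qed.

Lemma expandable_on_bounded U f a b : open_convex U -> expandable_on U f -> U a -> U b -> a <= b ->
  exists B, forall x, a <= x <= b -> f x <= B.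
Proof.
  intros HU Hf Ha Hb Hab. destruct (continuity_ab_maj f a b Hab) as [m [Hm _]].
  - intros x Hx. apply continuity_pt_filterlim. apply (expandable_on_continuous U f); auto.
    now apply (proj1 HU a x b).
  - now exists (f m).
Qed.

(** * Smoothing one kink *)

(** The value exp (- N * (x0 - c)^2) at the centre of the expansion is factored out,
and only the variation of the exponent around x0 is estimated by its norm. *)
Lemma expansion_gauss W x0 r M N c : 0 <= N -> expansion x0 r W M ->
  expansion x0 r (fun x => exp (- (W x + N * (x - c) ^ 2)))
    (exp (- (N * (x0 - c) ^ 2)) * exp (M + N * (r ^ 2 + 2 * Rabs (x0 - c) * r))).
Proof.
  intros HN HW. assert (Hr : 0 < r) by apply HW.
  apply expansion_ext with (fun x => exp (- (N * (x0 - c) ^ 2)) *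
    exp (- (1) * W x + - N * ((0 + 1 * (x - x0)) * (2 * (x0 - c) + 1 * (x - x0))))).
  { intros x _. rewrite <- exp_plus. f_equal. ring. }
  assert (Hs : forall f K, expansion x0 r f K -> expansion x0 r (fun x => exp (- (N * (x0 - c) ^ 2)) * f x)
    (exp (- (N * (x0 - c) ^ 2)) * K)).
  { intros f K HK. pose proof (expansion_scal _ _ _ _ (exp (- (N * (x0 - c) ^ 2))) HK) as H.
    rewrite Rabs_pos_eq in H by (left; apply exp_pos). exact H. }
  apply Hs, expansion_exp.
  pose proof (expansion_plus _ _ _ _ _ _ (expansion_scal _ _ _ _ (- (1)) HW)
    (expansion_scal _ _ _ _ (- N) (expansion_mult _ _ _ _ _ _ (expansion_affine x0 r 0 1 Hr)
       (expansion_affine x0 r (2 * (x0 - c)) 1 Hr)))) as HA.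
  refine (expansion_le _ _ _ _ _ _ (conj Hr (Rle_refl _)) _ HA).
  rewrite !Rabs_Ropp, Rabs_R1, Rabs_R0, (Rabs_pos_eq N), Rabs_mult, (Rabs_pos_eq 2) by lra.
  right; ring.
Qed.

Lemma expansion_prim2_on U (Phi F rho : R -> R) : open_convex U ->
  (forall x, U x -> is_derive Phi x (F x)) -> (forall x, U x -> is_derive F x (rho x)) ->
  expandable_on U rho -> expandable_on U Phi.
Proof.
  intros HU HPhi HF Hr x0 Hx0. destruct (Hr x0 Hx0) as [r [M HM]].
  destruct (proj2 HU x0 Hx0) as [d [Hd H]].
  assert (Hr0 : 0 < r) by apply HM.
  set (e := Rmin r d). assert (He : 0 < e) by now apply Rmin_glb_lt.
  pose proof (Rmin_l r d). pose proof (Rmin_r r d). fold e in H0, H1.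
  assert (HM' : expansion x0 e rho M) by (apply expansion_le with r M; auto; lra).
  assert (HA : expansion x0 (e/2) F (Rabs (F x0) + e * M)).
  { apply expansion_prim with rho; auto; [lra|]. intros x Hx. apply HF, H. lra. }
  exists (e/4), (Rabs (Phi x0) + e / 2 * (Rabs (F x0) + e * M)).
  apply expansion_prim with F; auto; [lra|]. intros x Hx. apply HPhi, H. lra.
Qed.

(** Smallness of a soft kink, in norm, around the points x0 on its left.  The bound
depends on x0 only through the norm M of the weight there; this is why series of
soft kinks whose positions run to the right end are analytic. *)
Definition small_left (U : R -> Prop) (W : R -> R) (k c g : R) (phi : R -> R) : Prop :=
  forall x0 r M, expansion x0 r W M -> U (x0 - r) -> U x0 -> 8 * r + g <= c - x0 ->
    expansion x0 (r / 4) phi (k * (2 + r ^ 2 * exp M)).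

(** Here y is the barycentre of the density, about which nothing more precise than
|y - c| <= 2 * s is known.  Mass: the density is at least
exp (- B - N * s^2 / 4) on [c, c + s/2], where B bounds W.  Tails: beyond distance s
of c they carry the factor exp (- N * s^2).  The quotient is of order
exp (- 3/4 * N * s^2), which N makes smaller than k.  The same comparison bounds the
norms on the left: with D = c - x0 >= 2 * s and 8 * r <= D the exponent
varies by at most 17/64 * N * D^2 around x0, and 47/64 * D^2 >= s^2. *)
Lemma soft_kink_near U eps W c s k :
  open_convex U -> bounded_below_on_compacts U eps -> (forall x, U x -> eps x <= 1) ->
  expandable_on U W -> (forall x, U x -> 0 <= W x) ->
  decays_from U eps W c ->
  0 < s -> U (c - s) -> U (c + s) -> 0 < k <= s ->
  exists y phi, Rabs (y - c) <= 2 * s /\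
    expandable_on U phi /\ convex_on U phi /\
    (forall x, U x -> 0 <= phi x /\ x - y <= phi x) /\
    (forall x, U x -> x <= c - s -> phi x <= k * eps x) /\
    (forall x, U x -> c + s <= x -> phi x <= x - y + k * eps x) /\
    (forall x, c - s <= x <= c + s -> phi x <= 3 * s) /\
    small_left U W k c (2 * s) phi.
Proof.
  intros HU Heps Heps1 HW HW0 [C [HC HCW]] Hs Hcs1 Hcs2 Hk.
  assert (Hc : U c) by (apply (proj1 HU (c - s) c (c + s)); auto; lra).
  pose proof (bounded_below_pos U eps Heps) as Hepos.
  destruct (expandable_on_bounded U W c (c + s) HU HW Hc Hcs2 ltac:(lra)) as [B HB].
  set (K := 2 * (C + 1) / s * exp B).
  assert (HK0 : 0 < 2 / s * exp B) by (apply Rmult_lt_0_compat; [apply Rdiv_lt_0_compat; lra | apply exp_pos]).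
  assert (HKe : K = 2 / s * exp B * C + 2 / s * exp B) by (unfold K; field; lra).
  assert (HK : 0 < K) by nra.
  destruct (exp_decay K (3 / 4 * s ^ 2) k) as [N [HN HNk]]; [lra | nra | lra |].
  specialize (HNk N (Rle_refl N)).
  set (rho := fun x => exp (- (W x + N * (x - c) ^ 2))).
  assert (Hrho_pos : forall x, 0 < rho x) by (intros; apply exp_pos).
  assert (Hrho : expandable_on U rho).
  { intros x0 Hx0. destruct (HW x0 Hx0) as [r [M HM]]. exists r. eexists.
    apply expansion_gauss; [lra | exact HM]. }
  destruct (primitive_on U c rho HU Hc) as [F [HFc HF]].
  { intros x Hx. now apply (expandable_on_continuous U). }
  destruct (primitive_on U c F HU Hc) as [Phi [HPhic HPhi]].
  { intros x Hx. apply (ex_derive_continuous (K := R_AbsRing) (V := R_NormedModule) F).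
    eexists. now apply HF. }
  set (T := fun x => C * eps x * exp (- (N * (x - c) ^ 2))).
  assert (HT : forall x t, U x -> U t -> c <= x <= t \/ t <= x <= c ->
     rho t <= T x * exp (- Rabs (t - x))).
  { intros x t Hx Ht Hxt. unfold rho, T. rewrite Ropp_plus_distr, exp_plus.
    specialize (HCW x t Hx Ht Hxt).
    replace (C * eps x * exp (- (N * (x - c) ^ 2)) * exp (- Rabs (t - x))) with
      (C * eps x * exp (- Rabs (t - x)) * exp (- (N * (x - c) ^ 2))) by ring.
    apply Rmult_le_compat; auto; try (left; apply exp_pos).
    apply exp_le, Ropp_le_contravar, Rmult_le_compat_l; [lra|].
    destruct Hxt; nra. }
  assert (HD : nonneg_second_derivative U Phi F rho).
  { intros x Hx. split; [|split]; auto. left; apply Hrho_pos. }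
  destruct (right_asymptote U Phi F rho c T HU HD Hc) as [P [Q [HP1 [HP2 HP3]]]].
  { intros x t Hx Ht H1 H2. rewrite <- (Rabs_pos_eq (t - x)) by lra. apply HT; auto. }
  destruct (left_asymptote U Phi F rho c T HU HD Hc) as [P' [Q' [HF2 [HL1 HL2]]]].
  { intros x t Hx Ht H1 H2. replace (x - t) with (- (t - x)) by ring.
    rewrite <- (Rabs_left1 (t - x)) by lra. apply HT; auto. }
  (* P and - P' bound the limits of F at the two ends, so Z bounds the total mass of rho. *)
  set (Z := P + P').
  assert (HZ : s / 2 * exp (- (B + N * (s / 2) ^ 2)) <= Z).
  { assert (Hc2 : U (c + s / 2)) by (apply (proj1 HU c _ (c + s)); auto; lra).
    destruct (mvt_on U F rho c (c + s / 2) HU Hc Hc2 HF) as [d [Hd [Hdc He]]].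
    rewrite Rmin_left, Rmax_right in Hdc by lra.
    pose proof (HP1 _ Hc2). pose proof (HF2 c Hc).
    assert (exp (- (B + N * (s / 2) ^ 2)) <= rho d).
    { apply exp_le, Ropp_le_contravar, Rplus_le_compat; [apply HB; lra|].
      apply Rmult_le_compat_l; [lra|]. nra. }
    unfold Z. nra. }
  assert (HZ0 : 0 < Z).
  { eapply Rlt_le_trans; [|exact HZ]. apply Rmult_lt_0_compat; [lra | apply exp_pos]. }
  assert (HZi : / Z <= 2 / s * exp B * exp (1 / 4 * (N * s ^ 2))).
  { apply Rle_trans with (/ (s / 2 * exp (- (B + N * (s / 2) ^ 2)))).
    - apply Rinv_le_contravar; auto. apply Rmult_lt_0_compat; [lra | apply exp_pos].
    - right. rewrite Rinv_mult, <- exp_Ropp, Ropp_involutive, exp_plus.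
      replace (N * (s / 2) ^ 2) with (1 / 4 * (N * s ^ 2)) by field. field. lra. }
  (* The common estimate of a quantity of order exp (- N * s^2) divided by the mass. *)
  assert (Hsmall : forall A, 0 <= A -> forall w, N * s ^ 2 <= w ->
     A <= C + 1 -> A * exp (- w) / Z <= k).
  { intros A HA w Hw HAC. eapply Rle_trans; [|exact HNk].
    unfold Rdiv. apply Rle_trans with (A * exp (- w) * (2 / s * exp B * exp (1 / 4 * (N * s ^ 2)))).
    - apply Rmult_le_compat_l; auto. apply Rmult_le_pos; auto. left; apply exp_pos.
    - replace (A * exp (- w) * (2 / s * exp B * exp (1 / 4 * (N * s ^ 2)))) with
        ((2 * A / s * exp B) * (exp (- w) * exp (1 / 4 * (N * s ^ 2)))) by (field; lra).
      rewrite <- exp_plus. apply Rmult_le_compat.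
      + repeat apply Rmult_le_pos; try lra; left; try apply exp_pos. now apply Rinv_0_lt_compat.
      + left; apply exp_pos.
      + unfold K. apply Rmult_le_compat_r; [left; apply exp_pos|].
        unfold Rdiv. apply Rmult_le_compat_r; [left; now apply Rinv_0_lt_compat|]. lra.
      + apply exp_le. lra. }
  assert (HTk : forall x, U x -> s <= Rabs (x - c) -> T x / Z <= k * eps x).
  { intros x Hx Hsx. specialize (Hepos x Hx).
    assert (Hsq : s ^ 2 <= (x - c) ^ 2).
    { rewrite <- (pow2_abs (x - c)). apply pow_incr. lra. }
    replace (T x / Z) with (C * exp (- (N * (x - c) ^ 2)) / Z * eps x) by (unfold T; field; lra).
    apply Rmult_le_compat_r; [lra|]. apply Hsmall; try lra. apply Rmult_le_compat_l; lra. }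
  set (phi := fun x => (Phi x + (P' * (x - c) + Q')) * / Z).
  set (phi' := fun x => (F x + P') * / Z).
  set (y := c + (Q - Q') / Z).
  assert (Hphi' : forall x, U x -> is_derive phi x (phi' x)).
  { intros x Hx. unfold phi, phi'.
    replace ((F x + P') * / Z) with (((F x + P' * 1) * / Z + (Phi x + (P' * (x - c) + Q')) * 0)) by ring.
    apply (is_derive_mult (fun x => Phi x + (P' * (x - c) + Q')) (fun _ => / Z)).
    - apply (is_derive_plus (K := R_AbsRing) (V := R_NormedModule) Phi); auto.
      auto_derive; auto; try ring.
    - auto_derive; auto.
    - intros; apply Rmult_comm. }
  assert (Hphi'' : forall x, U x -> is_derive phi' x (/ Z * rho x)).
  { intros x Hx. unfold phi'.
    replace (/ Z * rho x) with ((rho x + 0) * / Z + (F x + P') * 0) by ring.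
    apply (is_derive_mult (fun x => F x + P') (fun _ => / Z)).
    - apply (is_derive_plus (K := R_AbsRing) (V := R_NormedModule) F); auto.
      auto_derive; auto; try ring.
    - auto_derive; auto.
    - intros; apply Rmult_comm. }
  assert (HZi0 : 0 < / Z) by now apply Rinv_0_lt_compat.
  assert (Hphi_pos : forall x, U x -> 0 <= phi x).
  { intros x Hx. apply Rmult_le_pos; [|lra]. specialize (HL1 x Hx). lra. }
  assert (Hphi_y : forall x, phi x - (x - y) = (Phi x - (P * (x - c) - Q)) * / Z).
  { intros x. unfold phi, y, Z. field. fold Z. lra. }
  assert (Hphi_y0 : forall x, U x -> x - y <= phi x).
  { intros x Hx. enough (0 <= phi x - (x - y)) by lra. rewrite Hphi_y.
    apply Rmult_le_pos; [|lra]. specialize (HP2 x Hx). lra. }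
  assert (Hleft : forall x, U x -> x <= c - s -> phi x <= k * eps x).
  { intros x Hx Hxc. eapply Rle_trans; [|apply (HTk x Hx)].
    - apply Rmult_le_compat_r; [lra|]. specialize (HL2 x Hx ltac:(lra)). lra.
    - rewrite Rabs_left1; lra. }
  assert (Hright : forall x, U x -> c + s <= x -> phi x <= x - y + k * eps x).
  { intros x Hx Hxc. enough (phi x - (x - y) <= k * eps x) by lra. rewrite Hphi_y.
    eapply Rle_trans; [|apply (HTk x Hx)].
    - apply Rmult_le_compat_r; [lra|]. specialize (HP3 x Hx ltac:(lra)). lra.
    - rewrite Rabs_pos_eq; lra. }
  assert (Hk1 : forall x, U x -> k * eps x <= k).
  { intros x Hx. specialize (Heps1 x Hx). specialize (Hepos x Hx). nra. }
  assert (Hphi'1 : forall x, U x -> 0 <= phi' x <= 1).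
  { intros x Hx. unfold phi'. specialize (HP1 x Hx). specialize (HF2 x Hx). split.
    - apply Rmult_le_pos; lra.
    - apply Rmult_le_reg_r with Z; auto. rewrite Rmult_assoc, Rinv_l by lra. unfold Z. lra. }
  assert (Hconv : nonneg_second_derivative U phi phi' (fun x => / Z * rho x)).
  { intros x Hx. split; [|split]; auto. apply Rmult_le_pos; [lra|]. left; apply Hrho_pos. }
  exists y, phi. split; [|split; [|split; [|split; [|split; [|split; [|split]]]]]]; auto.
  - pose proof (Hphi_y0 _ Hcs1). pose proof (Hleft _ Hcs1 (Rle_refl _)).
    pose proof (Hphi_pos _ Hcs2). pose proof (Hright _ Hcs2 (Rle_refl _)).
    pose proof (Hk1 _ Hcs1). pose proof (Hk1 _ Hcs2). apply Rabs_le. lra.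
  - apply (expansion_prim2_on U phi phi' (fun x => / Z * rho x)); auto.
    intros x0 Hx0. destruct (Hrho x0 Hx0) as [r [M HM]]. exists r. eexists. apply expansion_scal, HM.
  - now apply (convex_of_second_derivative U phi phi' (fun x => / Z * rho x)).
  - intros x Hx. assert (HUx : U x) by now apply (proj1 HU (c - s) x (c + s)).
    destruct (mvt_on U phi phi' (c - s) x HU Hcs1 HUx Hphi') as [d [Hd [_ He]]].
    specialize (Hphi'1 d Hd). pose proof (Hleft _ Hcs1 (Rle_refl _)). pose proof (Hk1 _ Hcs1). nra.
  - intros x0 r M HM Hx0r Hx0 Hgap.
    assert (Hr : 0 < r) by apply HM.
    assert (HUr : forall x, Rabs (x - x0) < r -> U x).
    { intros x Hx. apply Rabs_lt_between in Hx. apply (proj1 HU (x0 - r) x c); auto; lra. }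
    assert (Hxr : U (x0 + r / 2)) by (apply HUr; rewrite Rabs_pos_eq; lra).
    assert (HA : expansion x0 r (fun x => / Z * rho x) (k * exp M)).
    { pose proof (expansion_scal _ _ _ _ (/ Z) (expansion_gauss W x0 r M N c ltac:(lra) HM)) as HA.
      refine (expansion_le _ _ _ _ _ _ (conj Hr (Rle_refl _)) _ HA).
      rewrite (Rabs_pos_eq (/ Z)), (Rabs_left1 (x0 - c)) by lra.
      rewrite (exp_plus M).
      assert (He : 1 * exp (- (N * (47 / 64 * (x0 - c) ^ 2))) / Z <= k).
      { apply Hsmall; try lra. apply Rmult_le_compat_l; [lra|]. nra. }
      replace (/ Z * (exp (- (N * (x0 - c) ^ 2)) * (exp M * exp (N * (r ^ 2 + 2 * - (x0 - c) * r)))))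
        with (/ Z * (exp (- (N * (x0 - c) ^ 2)) * exp (N * (r ^ 2 + 2 * - (x0 - c) * r))) * exp M) by ring.
      apply Rmult_le_compat_r; [left; apply exp_pos|].
      eapply Rle_trans; [|exact He]. rewrite <- exp_plus. unfold Rdiv. rewrite Rmult_1_l, Rmult_comm.
      apply Rmult_le_compat_r; [lra|]. apply exp_le.
      enough (0 <= N * (17 / 64 * (x0 - c) ^ 2 - (r ^ 2 + 2 * - (x0 - c) * r))) by lra.
      apply Rmult_le_pos; [lra|]. 
      assert (0 <= (- (x0 - c) - 8 * r) * (1/8 * r + 17 / 64 * - (x0 - c) )) by (apply Rmult_le_pos; lra).
      nra. }
    assert (HB1 : phi x0 <= k).
    { eapply Rle_trans; [apply Hleft; auto; lra | now apply Hk1]. }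
    assert (HB2 : phi (x0 + r / 2) <= k).
    { eapply Rle_trans; [apply Hleft; auto; lra | now apply Hk1]. }
    (* The derivative at x0 is read off from the values, by convexity. *)
    assert (HB3 : phi' x0 * (r / 2) <= k).
    { pose proof (above_tangent U phi phi' _ (x0 + r / 2) x0 HU Hconv Hxr Hx0).
      specialize (Hphi_pos x0 Hx0). lra. }
    assert (HA' : expansion x0 (r / 2) phi' (Rabs (phi' x0) + r * (k * exp M))).
    { apply expansion_prim with (fun x => / Z * rho x); auto. lra. }
    assert (HA'' : expansion x0 (r / 4) phi (Rabs (phi x0) + r / 2 * (Rabs (phi' x0) + r * (k * exp M)))).
    { apply expansion_prim with phi'; auto; [lra|]. intros x Hx. apply Hphi', HUr. lra. }
    refine (expansion_le _ _ _ _ _ _ (conj _ (Rle_refl _)) _ HA''); [lra|].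
    rewrite !Rabs_pos_eq by (auto; apply Hphi'1; auto).
    assert (0 <= r ^ 2 * (k * exp M)).
    { apply Rmult_le_pos; [nra|]. apply Rmult_le_pos; [lra | left; apply exp_pos]. }
    nra.
Qed.

Lemma convex_on_combination U f g a b :
  convex_on U f -> convex_on U g -> 0 <= a -> 0 <= b ->
  convex_on U (fun x => a * f x + b * g x).
Proof.
  intros Hf Hg Ha Hb x y t Hx Hy Ht.
  specialize (Hf x y t Hx Hy Ht). specialize (Hg x y t Hx Hy Ht).
  apply Rmult_le_compat_l with (r := a) in Hf; auto.
  apply Rmult_le_compat_l with (r := b) in Hg; auto. lra.
Qed.

(** A convex combination of two soft kinks whose barycentres y1 < y < y2 average to
y: the asymptotes are then exactly 0 and x - y.  The radius d is so small that the
error near y, where the two kinks do not match, is below k * eps; farther away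
the errors of the two pieces simply add up. *)
Lemma soft_kink U eps W y s k :
  open_convex U -> bounded_below_on_compacts U eps -> (forall x, U x -> eps x <= 1) ->
  expandable_on U W -> (forall x, U x -> 0 <= W x) ->
  (forall c, U c -> decays_from U eps W c) ->
  0 < s -> U (y - s) -> U (y + s) -> 0 < k ->
  exists phi, expandable_on U phi /\ convex_on U phi /\
    (forall x, U x -> Rmax 0 (x - y) <= phi x <= Rmax 0 (x - y) + k * eps x) /\
    small_left U W k y s phi.
Proof.
  intros HU Heps Heps1 HW HW0 HWC Hs Hy1 Hy2 Hk.
  destruct (Heps _ _ Hy1 Hy2) as [e [He Hee]].
  pose proof (bounded_below_pos U eps Heps) as Hepos.
  assert (HUy : forall x, y - s <= x <= y + s -> U x).
  { intros x Hx. now apply (proj1 HU (y - s) x (y + s)). }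
  assert (Hke : 0 < k * e) by now apply Rmult_lt_0_compat.
  set (d := Rmin (s / 5) (k * e / 6)).
  assert (Hd : 0 < d) by (apply Rmin_glb_lt; lra).
  assert (Hd1 : 5 * d <= s) by (pose proof (Rmin_l (s / 5) (k * e / 6)); fold d in H; lra).
  assert (Hd2 : 6 * d <= k * e) by (pose proof (Rmin_r (s / 5) (k * e / 6)); fold d in H; lra).
  set (k' := Rmin k d).
  assert (Hk' : 0 < k') by (apply Rmin_glb_lt; lra).
  assert (Hk'k : k' <= k) by apply Rmin_l.
  assert (Hk'd : k' <= d) by apply Rmin_r.
  (* The barycentre is within 2 * d of c, so c = y - 3 * d puts it on the left of y and
     c = y + 3 * d on the right. *)
  assert (Hb : forall c, y - 3 * d <= c <= y + 3 * d -> exists yc phi,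
    Rabs (yc - c) <= 2 * d /\
    expandable_on U phi /\ convex_on U phi /\
    (forall x, U x -> 0 <= phi x /\ x - yc <= phi x) /\
    (forall x, U x -> x <= y - 4 * d -> phi x <= k * eps x) /\
    (forall x, U x -> y + 4 * d <= x -> phi x <= x - yc + k * eps x) /\
    (forall x, y - 4 * d <= x <= y + 4 * d -> phi x <= Rmax 0 (x - y) + k * eps x) /\
    small_left U W k y s phi).
  { intros c Hc.
    destruct (soft_kink_near U eps W c d k') as [yc [phi [H1 [H2 [H3 [H4 [H5 [H6 [H7 H8]]]]]]]]]; auto.
    { apply HWC, HUy; lra. }
    { apply HUy; lra. }
    { apply HUy; lra. }
    assert (Hkk : forall x, U x -> k' * eps x <= k * eps x).
    { intros x Hx. specialize (Hepos x Hx). apply Rmult_le_compat_r; lra. }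
    assert (Hkd : forall x, U x -> k' * eps x <= d).
    { intros x Hx. specialize (Hepos x Hx). specialize (Heps1 x Hx).
      apply Rle_trans with (d * 1); [|lra]. apply Rmult_le_compat; lra. }
    exists yc, phi. split; [|split; [|split; [|split; [|split; [|split; [|split]]]]]]; auto.
    - intros x Hx Hxy. specialize (Hkk x Hx). specialize (H5 x Hx ltac:(lra)). lra.
    - intros x Hx Hxy. specialize (Hkk x Hx). specialize (H6 x Hx ltac:(lra)). lra.
    - intros x Hx. assert (Hx' : U x) by (apply HUy; lra).
      assert (k * e <= k * eps x) by (apply Rmult_le_compat_l; [lra|]; apply Hee; lra).
      specialize (Hkd x Hx'). apply Rabs_le_between in H1.
      pose proof (Rmax_l 0 (x - y)). pose proof (Rmax_r 0 (x - y)).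
      destruct (Rle_dec x (c - d)) as [Hx1|Hx1]; [specialize (H5 x Hx' Hx1); lra|].
      destruct (Rle_dec (c + d) x) as [Hx2|Hx2]; [specialize (H6 x Hx' Hx2); lra|].
      specialize (H7 x ltac:(lra)). lra.
    - intros x0 r M HM Hx0r Hx0 Hg. assert (0 < r) by apply HM.
      assert (HA : expansion x0 (r / 4) phi (k' * (2 + r ^ 2 * exp M))).
      { apply H8; auto. lra. }
      refine (expansion_le _ _ _ _ _ _ (conj _ (Rle_refl _)) _ HA); [lra|].
      apply Rmult_le_compat_r; auto. pose proof (exp_pos M). nra. }
  destruct (Hb (y - 3 * d) ltac:(lra)) as [y1 [f1 [A1 [A2 [A3 [A4 [A5 [A6 [A7 A8]]]]]]]]].
  destruct (Hb (y + 3 * d) ltac:(lra)) as [y2 [f2 [B1 [B2 [B3 [B4 [B5 [B6 [B7 B8]]]]]]]]].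
  clear Hb. apply Rabs_le_between in A1, B1.
  set (a := (y2 - y) / (y2 - y1)). set (b := (y - y1) / (y2 - y1)).
  assert (Ha : 0 <= a) by (apply Rlt_le, Rdiv_lt_0_compat; lra).
  assert (Hb : 0 <= b) by (apply Rlt_le, Rdiv_lt_0_compat; lra).
  assert (Hab : a + b = 1) by (unfold a, b; field; lra).
  assert (Haby : a * y1 + b * y2 = y) by (unfold a, b; field; lra).
  assert (Hcomb : forall u v m, u <= m -> v <= m -> a * u + b * v <= m).
  { intros u v m Hu Hv. apply Rmult_le_compat_l with (r := a) in Hu; auto.
    apply Rmult_le_compat_l with (r := b) in Hv; auto. nra. }
  exists (fun x => a * f1 x + b * f2 x). split; [|split; [|split]].
  - apply (expandable_on_plus U (fun x => a * f1 x) (fun x => b * f2 x)).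
    + intros x Hx. destruct (A2 x Hx) as [r [M HM]]. exists r. eexists. apply expansion_scal, HM.
    + intros x Hx. destruct (B2 x Hx) as [r [M HM]]. exists r. eexists. apply expansion_scal, HM.
  - now apply convex_on_combination.
  - intros x Hx. specialize (A4 x Hx). specialize (B4 x Hx). specialize (Hepos x Hx). split.
    + apply Rmax_lub.
      * apply Rplus_le_le_0_compat; apply Rmult_le_pos; lra.
      * replace (x - y) with (a * (x - y1) + b * (x - y2)) by (rewrite <- Haby; nra).
        apply Rplus_le_compat; apply Rmult_le_compat_l; lra.
    + destruct (Rle_dec x (y - 4 * d)) as [Hx1|Hx1].
      { rewrite Rmax_left by lra. rewrite Rplus_0_l. apply Hcomb; auto. }
      destruct (Rle_dec (y + 4 * d) x) as [Hx2|Hx2].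
      { rewrite Rmax_right by lra.
        replace (x - y + k * eps x) with (a * (x - y1 + k * eps x) + b * (x - y2 + k * eps x))
          by (rewrite <- Haby; nra).
        apply Rplus_le_compat; apply Rmult_le_compat_l; auto. }
      apply Hcomb; [apply A7 | apply B7]; lra.
  - intros x0 r M HM Hx0r Hx0 Hg. assert (0 < r) by apply HM.
    pose proof (expansion_plus _ _ _ _ _ _ (expansion_scal _ _ _ _ a (A8 x0 r M HM Hx0r Hx0 Hg))
      (expansion_scal _ _ _ _ b (B8 x0 r M HM Hx0r Hx0 Hg))) as HA.
    refine (expansion_le _ _ _ _ _ _ (conj _ (Rle_refl _)) _ HA); [lra|].
    rewrite !Rabs_pos_eq by auto. apply Hcomb; lra.
Qed.

(** * Convex functions as sums of kinks *)

Lemma convex_3 U f x y z : convex_on U f -> U x -> U z -> x <= y <= z -> x < z ->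
  f y * (z - x) <= (z - y) * f x + (y - x) * f z.
Proof.
  intros Hf Hx Hz Hy Hxz. specialize (Hf x z ((z - y) / (z - x)) Hx Hz).
  assert (Ht : 0 <= (z - y) / (z - x) <= 1).
  { split.
    - apply Rmult_le_pos; [lra|]. left; apply Rinv_0_lt_compat; lra.
    - apply Rmult_le_reg_r with (z - x); [lra|]. unfold Rdiv. rewrite Rmult_assoc, Rinv_l; lra. }
  specialize (Hf Ht).
  replace ((z - y) / (z - x) * x + (1 - (z - y) / (z - x)) * z) with y in Hf by (field; lra).
  apply Rmult_le_compat_r with (r := z - x) in Hf; [|lra].
  replace (((z - y) / (z - x) * f x + (1 - (z - y) / (z - x)) * f z) * (z - x))
    with ((z - y) * f x + (y - x) * f z) in Hf by (field; lra). exact Hf.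
Qed.

Lemma is_series_finite (a : nat -> R) n :
  (forall k, (n < k)%nat -> a k = 0) -> is_series a (sum_n a n).
Proof.
  intros Ha.
  change (is_lim_seq (sum_n a) (sum_n a n)).
  apply is_lim_seq_ext_loc with (fun _ => sum_n a n); [|apply is_lim_seq_const].
  exists n. intros m Hm. induction Hm as [|m Hm IH]; auto.
  rewrite sum_Sn, Ha by lia. unfold plus; simpl. lra.
Qed.

(** The terms are nonnegative, so that the inequality between the sums follows by
comparison of series. *)
Lemma convex_series U (f : nat -> R -> R) : open_convex U ->
  (forall i, convex_on U (f i)) -> (forall i x, U x -> 0 <= f i x) ->
  (forall x, U x -> ex_series (fun i => f i x)) ->
  convex_on U (fun x => Series (fun i => f i x)).
Proof.
  intros HU Hc Hp He x y t Hx Hy Ht.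
  rewrite <- !Series_scal_l, <- Series_plus by (apply ex_series_cmul; auto).
  apply Series_le.
  - intros i. split; [|now apply Hc]. apply Hp.
    destruct (Rle_dec x y).
    + apply (proj1 HU x _ y); auto. nra.
    + apply (proj1 HU y _ x); auto. nra.
  - apply (ex_series_plus (K := R_AbsRing) (V := R_NormedModule) (fun i => t * f i x));
      apply ex_series_cmul; auto.
Qed.

Lemma expandable_on_sum U (f : nat -> R -> R) n :
  (forall i, expandable_on U (f i)) -> expandable_on U (fun x => sum_f_R0 (fun i => f i x) n).
Proof.
  intros H. induction n as [|n IH]; simpl; [apply H|].
  now apply (expandable_on_plus U (fun x => sum_f_R0 (fun i => f i x) n)).
Qed.

(** Near x0 it is enough to sum the norms of a tail; the finitely many remaining
terms may have arbitrarily small radii. *)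
Lemma expandable_on_series U (f : nat -> R -> R) :
  open_convex U -> (forall i, expandable_on U (f i)) ->
  (forall x, U x -> ex_series (fun i => f i x)) ->
  (forall x0, U x0 -> exists k r M, 0 < r /\ ex_series M /\
     forall i, expansion x0 r (f (S k + i)%nat) (M i)) ->
  expandable_on U (fun x => Series (fun i => f i x)).
Proof.
  intros HU Hf Hs Ht x0 Hx0. destruct (Ht x0 Hx0) as [k [r [M [Hr [HM Htl]]]]].
  destruct (proj2 HU x0 Hx0) as [d [Hd HUd]].
  destruct (expandable_on_sum U f k Hf x0 Hx0) as [r1 [M1 HM1]].
  assert (Hr1 : 0 < r1) by apply HM1.
  assert (Htail : expansion x0 r (fun x => Series (fun i => f (S k + i)%nat x)) (Series M)).
  { now apply expansion_series with (fun i => f (S k + i)%nat). }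
  set (q := Rmin (Rmin r1 d) r). assert (Hq : 0 < q) by (repeat apply Rmin_glb_lt; lra).
  pose proof (Rmin_l (Rmin r1 d) r). pose proof (Rmin_r (Rmin r1 d) r).
  pose proof (Rmin_l r1 d). pose proof (Rmin_r r1 d). fold q in H, H0.
  exists q, (M1 + Series M).
  apply expansion_ext with (fun x => sum_f_R0 (fun i => f i x) k + Series (fun i => f (S k + i)%nat x)).
  - intros x Hx. rewrite (Series_incr_n (fun i => f i x) (S k)); [reflexivity | lia |].
    apply Hs, HUd. lra.
  - apply expansion_plus.
    + apply expansion_le with (3 := HM1); [lra | apply Rle_refl].
    + apply expansion_le with (3 := Htail); [lra | apply Rle_refl].
Qed.

Definition chord_slope (f : R -> R) (xs : nat -> R) (n : nat) : R :=
  (f (xs (S n)) - f (xs n)) / (xs (S n) - xs n).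

(** The slope on the left of the first point counts as 0. *)
Definition slope_jump (f : R -> R) (xs : nat -> R) (n : nat) : R :=
  match n with
  | O => chord_slope f xs O
  | S m => chord_slope f xs (S m) - chord_slope f xs m
  end.

Lemma chord_slope_mult f xs n : xs n < xs (S n) ->
  f (xs (S n)) - f (xs n) = chord_slope f xs n * (xs (S n) - xs n).
Proof. intros H. unfold chord_slope. field. lra. Qed.

Lemma slope_jump_ge0 U f xs :
  convex_on U f -> (forall n, U (xs n)) -> (forall n, xs n < xs (S n)) ->
  f (xs O) <= f (xs 1%nat) -> forall n, 0 <= slope_jump f xs n.
Proof.
  intros Hf HUx Hinc H01 [|n]; unfold slope_jump.
  - pose proof (chord_slope_mult f xs O (Hinc O)). pose proof (Hinc O).
    apply Rnot_lt_le. intros Hlt. nra.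
  - pose proof (convex_3 U f (xs n) (xs (S n)) (xs (S (S n))) Hf (HUx _) (HUx _)) as H.
    pose proof (Hinc n). pose proof (Hinc (S n)). specialize (H ltac:(lra) ltac:(lra)).
    pose proof (chord_slope_mult f xs n (Hinc n)) as H3.
    pose proof (chord_slope_mult f xs (S n) (Hinc (S n))) as H4.
    set (s := chord_slope f xs n) in *. set (s' := chord_slope f xs (S n)) in *.
    assert (Hpr : 0 < (xs (S n) - xs n) * (xs (S (S n)) - xs (S n))) by (apply Rmult_lt_0_compat; lra).
    apply Rnot_lt_le. intros Hlt.
    assert (0 <= (s' - s) * ((xs (S n) - xs n) * (xs (S (S n)) - xs (S n)))); [|nra].
    replace ((s' - s) * ((xs (S n) - xs n) * (xs (S (S n)) - xs (S n)))) with
      ((s' * (xs (S (S n)) - xs (S n))) * (xs (S n) - xs n) -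
       (s * (xs (S n) - xs n)) * (xs (S (S n)) - xs (S n))) by ring.
    rewrite <- H3, <- H4. nra.
Qed.

(** The kinks at the points up to x_n add up to the affine function that
continues the n-th chord of f. *)
Lemma sum_kinks f xs x n : (forall n, xs n < xs (S n)) -> f (xs O) = 0 -> xs n <= x ->
  sum_n (fun i => slope_jump f xs i * Rmax 0 (x - xs i)) n =
  f (xs n) + chord_slope f xs n * (x - xs n).
Proof.
  intros Hinc H0. induction n as [|n IH]; intros Hx.
  - rewrite sum_O, H0, Rmax_right by lra. simpl. lra.
  - rewrite sum_Sn, IH by (specialize (Hinc n); lra).
    rewrite Rmax_right by lra. unfold plus; simpl.
    pose proof (chord_slope_mult f xs n (Hinc n)). lra.
Qed.

(** Admissible steps have a locally uniform length because f, being nonnegative,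
has slopes bounded near L by f z / (z - L - d) for a fixed z on the right. *)
Lemma fine_mesh U p f eps :
  open_convex U -> U p -> bounded_below_on_compacts U eps ->
  convex_on U f -> (forall x, U x -> 0 <= f x) -> f p = 0 ->
  exists xs : nat -> R, xs O = p /\
    (forall n, U (xs n) /\ xs n < xs (S n) /\
       forall t, xs n <= t <= xs (S n) -> f (xs (S n)) - f (xs n) <= eps t) /\
    (forall z, U z -> exists n, z < xs n).
Proof.
  intros HU Hp Heps Hf Hf0 Hfp.
  destruct (exhausting_sequence U (fun x y => p <= x -> forall t, x <= t <= y -> f y - f x <= eps t) p HU Hp)
    as [xs [H0 [Hxs Hex]]].
  - intros L HL. destruct (proj2 HU L HL) as [d0 [Hd0 HUL]].
    set (d := d0 / 2). assert (Hd : 0 < d) by (unfold d; lra).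
    assert (HUd : forall y, L - 2 * d <= y <= L + 2 * d -> U y).
    { intros y Hy. apply HUL. apply Rabs_le. unfold d in Hy. lra. }
    destruct (Heps (L - d) (L + d)) as [e [He Hee]]; try (apply HUd; lra).
    set (z := L + 2 * d). assert (Hz : U z) by (apply HUd; unfold z; lra).
    pose proof (Hf0 z Hz) as Hfz.
    assert (Hq : 0 < e * d / (2 * (f z + 1))).
    { apply Rdiv_lt_0_compat; [now apply Rmult_lt_0_compat | lra]. }
    exists (Rmin d (e * d / (2 * (f z + 1)))). split; [now apply Rmin_glb_lt|].
    pose proof (Rmin_l d (e * d / (2 * (f z + 1)))) as H1.
    pose proof (Rmin_r d (e * d / (2 * (f z + 1)))) as H2.
    set (m := Rmin d (e * d / (2 * (f z + 1)))) in *.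
    intros x y Hx Hxy Hy Hpx t Ht.
    apply Rle_trans with e; [|apply Hee; lra].
    assert (Hxz : y < z) by (unfold z; lra).
    pose proof (convex_3 U f x y z Hf ltac:(apply HUd; lra) Hz ltac:(lra) ltac:(lra)) as H3.
    pose proof (Hf0 y ltac:(apply HUd; lra)) as Hfy.
    assert (H4 : m * (2 * (f z + 1)) <= e * d).
    { apply Rmult_le_compat_r with (r := 2 * (f z + 1)) in H2; [|lra].
      unfold Rdiv in H2. rewrite Rmult_assoc, Rinv_l in H2 by lra. lra. }
    assert (H5 : (f y - f x) * (z - y) <= (y - x) * f z) by nra.
    assert (H6 : (y - x) * f z <= 2 * m * (f z + 1)).
    { apply Rmult_le_compat; lra. }
    assert (d <= z - y) by (unfold z; lra).
    apply Rnot_lt_le. intros Hlt. nra.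
  - exists xs. split; auto. split; auto.
    intros n. destruct (Hxs n) as [H1 [H2 H3]]. split; [|split]; auto.
    apply H3. rewrite <- H0. apply increasing_le; [|lia]. intros; apply Hxs.
Qed.

(** * Approximation on one side, and on the whole interval *)

(** The error has two parts, each at most eps / 2: that of the interpolation, and the
sum of the errors of the soft kinks, which is a geometric series. *)
Lemma right_half U p f eps :
  open_convex U -> U p -> bounded_below_on_compacts U eps -> (forall x, U x -> eps x <= 1) ->
  convex_on U f -> (forall x, U x -> 0 <= f x) -> f p = 0 ->
  exists g, expandable_on U g /\ convex_on U g /\
    (forall x, U x -> p <= x -> Rabs (f x - g x) <= eps x) /\
    (forall x, U x -> x <= p -> Rabs (g x) <= eps x).
Proof.
  intros HU Hp Heps Heps1 Hf Hf0 Hfp.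
  pose proof (bounded_below_pos U eps Heps) as Hepos.
  destruct (exists_weight U eps HU Heps (ex_intro _ p Hp)) as [W [HW [HW0 HWC]]].
  destruct (fine_mesh U p f (fun x => eps x / 2)) as [xs [H0 [Hxs Hex]]]; auto.
  { intros a b Ha Hb. destruct (Heps a b Ha Hb) as [e [He H]]. exists (e / 2). split; [lra|].
    intros x Hx. specialize (H x Hx). lra. }
  assert (Hinc : forall n, xs n < xs (S n)) by (intros; apply Hxs).
  assert (HUx : forall n, U (xs n)) by (intros; apply Hxs).
  assert (Hpx : forall n, p <= xs n).
  { intros n. rewrite <- H0. apply increasing_le; auto. lia. }
  assert (Hmono : forall x y, U y -> p <= x <= y -> f x <= f y).
  { intros x y Hy Hxy. destruct (Req_dec x y) as [->|Hne]; [lra|].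
    pose proof (convex_3 U f p x y Hf Hp Hy ltac:(lra) ltac:(lra)). rewrite Hfp in H.
    pose proof (Hf0 y Hy). nra. }
  set (c := slope_jump f xs).
  assert (Hc : forall n, 0 <= c n).
  { apply (slope_jump_ge0 U); auto. apply Hmono; auto. pose proof (Hinc O). lra. }
  assert (Hh : forall x n, xs n <= x -> sum_n (fun i => c i * Rmax 0 (x - xs i)) n =
     f (xs n) + chord_slope f xs n * (x - xs n)).
  { intros x n. apply sum_kinks; auto. now rewrite H0. }
  (* Relative precision of the n-th soft kink; 1 + c n avoids a division by 0. *)
  set (kp := fun n => / 4 * (1 / 2) ^ n / (1 + c n)).
  assert (Hkp : forall n, 0 < kp n).
  { intros n. apply Rdiv_lt_0_compat; [|specialize (Hc n); lra].
    apply Rmult_lt_0_compat; [lra|]. apply pow_lt; lra. }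
  assert (Hckp : forall n, c n * kp n <= / 4 * (1 / 2) ^ n).
  { intros n. specialize (Hc n). apply Rle_trans with ((1 + c n) * kp n).
    - apply Rmult_le_compat_r; [left; apply Hkp | lra].
    - unfold kp. right. field. lra. }
  assert (Hphi : forall n, exists phi, expandable_on U phi /\ convex_on U phi /\
    (forall x, U x -> Rmax 0 (x - xs n) <= phi x <= Rmax 0 (x - xs n) + kp n * eps x) /\
    forall x0 r M, expansion x0 r W M -> U (x0 - r) -> U x0 -> x0 + 8 * r <= xs (pred n) -> (0 < n)%nat ->
     expansion x0 (r / 4) phi (kp n * (2 + r ^ 2 * exp M))).
  { intros n. destruct (proj2 HU (xs n) (HUx n)) as [d [Hd HUd]].
    (* The gap in small_left must not reach beyond the previous point, so that the kinks
       from x_(k+1) on are all small around each x0 < x_k. *)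
    assert (Hs : exists s, 0 < s <= d /\ ((0 < n)%nat -> s <= xs n - xs (pred n))).
    { destruct n as [|n].
      - exists d. split; [lra | lia].
      - simpl. specialize (Hinc n). exists (Rmin d (xs (S n) - xs n)). split.
        + split; [apply Rmin_glb_lt; lra | apply Rmin_l].
        + intros _. apply Rmin_r. }
    destruct Hs as [s [Hs1 Hs2]].
    destruct (soft_kink U eps W (xs n) s (kp n)) as [phi [P1 [P2 [P3 P4]]]]; auto; try lra.
    { apply HUd. apply Rabs_le. lra. }
    { apply HUd. apply Rabs_le. lra. }
    exists phi. split; [|split; [|split]]; auto.
    intros x0 r M HM Hx0r Hx0 Hg Hn. apply P4; auto. specialize (Hs2 Hn). lra. }
  apply choice in Hphi. destruct Hphi as [phi Hphi].
  assert (Hgeo : ex_series (fun n => / 4 * (1 / 2) ^ n)).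
  { apply ex_series_cmul, ex_series_geom. rewrite Rabs_pos_eq; lra. }
  assert (Hgeo2 : Series (fun n => / 4 * (1 / 2) ^ n) = / 2).
  { rewrite (Series_scal_l (/ 4) (fun n => (1 / 2) ^ n)), (Series_geom (1 / 2)); [field | rewrite Rabs_pos_eq; lra]. }
  set (d := fun x n => c n * (phi n x - Rmax 0 (x - xs n))).
  set (h := fun x n => c n * Rmax 0 (x - xs n)).
  assert (Hd : forall x n, U x -> 0 <= d x n <= eps x * (/ 4 * (1 / 2) ^ n)).
  { intros x n Hx. destruct (Hphi n) as [_ [_ [H _]]]. specialize (H x Hx). unfold d. split.
    - apply Rmult_le_pos; [apply Hc | lra].
    - apply Rle_trans with (c n * (kp n * eps x)); [apply Rmult_le_compat_l; [apply Hc | lra]|].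
      specialize (Hckp n). specialize (Hepos x Hx). nra. }
  assert (Hds : forall x, U x -> ex_series (d x)).
  { intros x Hx. apply ex_series_dom with (fun n => eps x * (/ 4 * (1 / 2) ^ n)).
    - intros n. rewrite Rabs_pos_eq; now apply Hd.
    - now apply ex_series_cmul. }
  assert (Hdb : forall x, U x -> 0 <= Series (d x) <= eps x / 2).
  { intros x Hx. split.
    - apply Series_ge0; auto. intros n; now apply Hd.
    - replace (eps x / 2) with (Series (fun n => eps x * (/ 4 * (1 / 2) ^ n))).
      + apply Series_le; [intros n; now apply Hd | now apply ex_series_cmul].
      + rewrite Series_scal_l, Hgeo2. field. }
  assert (Hhs : forall x n, x <= xs (S n) -> is_series (h x) (sum_n (h x) n)).
  { intros x n Hx. apply is_series_finite. intros k Hk. unfold h.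
    pose proof (increasing_le xs Hinc (S n) k ltac:(lia)). rewrite Rmax_left by lra. ring. }
  assert (Hhe : forall x, U x -> ex_series (h x)).
  { intros x Hx. destruct (Hex x Hx) as [n Hn]. eexists. apply (Hhs x n).
    specialize (Hinc n); lra. }
  set (T := fun n x => c n * phi n x).
  assert (HT : forall n x, d x n + h x n = T n x) by (intros; unfold d, h, T; ring).
  assert (HTs : forall x, U x -> ex_series (fun n => T n x)).
  { intros x Hx. apply ex_series_ext with (fun n => d x n + h x n); auto.
    apply (ex_series_plus (K := R_AbsRing) (V := R_NormedModule) (d x)); auto. }
  assert (HTe : forall x, U x -> Series (fun n => T n x) = Series (d x) + Series (h x)).
  { intros x Hx. rewrite <- Series_plus by auto. apply Series_ext. intros; now rewrite HT. }
  exists (fun x => Series (fun n => T n x)). split; [|split; [|split]].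
  - apply expandable_on_series; auto.
    { intros i x Hx. destruct (Hphi i) as [Hi _].
      destruct (Hi x Hx) as [ri [Mi HMi]]. exists ri. eexists. apply expansion_scal, HMi. }
    intros x0 Hx0. destruct (Hex x0 Hx0) as [k Hk].
    destruct (HW x0 Hx0) as [r0 [M HM]]. assert (Hr0 : 0 < r0) by apply HM.
    destruct (proj2 HU x0 Hx0) as [d0 [Hd0 HUd]].
    set (r := Rmin (Rmin r0 d0) ((xs k - x0) / 8)).
    assert (Hr : 0 < r) by (repeat apply Rmin_glb_lt; lra).
    assert (Hr1 : r <= Rmin r0 d0) by apply Rmin_l.
    assert (Hr2 : r <= (xs k - x0) / 8) by apply Rmin_r.
    pose proof (Rmin_l r0 d0). pose proof (Rmin_r r0 d0).
    assert (HMr : expansion x0 r W M) by (apply expansion_le with r0 M; auto; lra).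
    set (A := 2 + r ^ 2 * exp M). assert (HA : 0 <= A) by (unfold A; pose proof (exp_pos M); nra).
    exists k, (r / 4), (fun n => / 4 * (1 / 2) ^ (S k + n) * A). split; [lra|]. split.
    + apply (ex_series_incr_n (fun n => / 4 * (1 / 2) ^ n * A) (S k)).
      apply ex_series_ext with (fun n => A * (/ 4 * (1 / 2) ^ n)); [intros; apply Rmult_comm|].
      now apply ex_series_cmul.
    + intros n. destruct (Hphi (S k + n)%nat) as [_ [_ [_ Hn]]].
      assert (HB : expansion x0 (r / 4) (phi (S k + n)%nat) (kp (S k + n)%nat * A)).
      { apply Hn; auto; [| |lia].
        - apply HUd. apply Rabs_le. lra.
        - pose proof (increasing_le xs Hinc k (pred (S k + n)) ltac:(lia)). lra. }
      apply (expansion_scal _ _ _ _ (c (S k + n)%nat)) in HB.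
      refine (expansion_le _ _ _ _ _ _ (conj _ (Rle_refl _)) _ HB); [lra|].
      rewrite Rabs_pos_eq, <- Rmult_assoc by auto. apply Rmult_le_compat_r; auto.
  - apply convex_series; auto.
    + intros i x y t Hx Hy Ht. destruct (Hphi i) as [_ [H _]].
      specialize (H x y t Hx Hy Ht). unfold T.
      apply Rmult_le_compat_l with (r := c i) in H; auto. lra.
    + intros i x Hx. destruct (Hphi i) as [_ [_ [H _]]]. specialize (H x Hx).
      apply Rmult_le_pos; auto. pose proof (Rmax_l 0 (x - xs i)). lra.
  - intros x Hx Hpx'. rewrite HTe by auto. specialize (Hdb x Hx).
    destruct (Hex x Hx) as [m Hm].
    destruct (bracket xs x m ltac:(lra)) as [n [Hn1 Hn2]].
    rewrite (is_series_unique _ _ (Hhs x n ltac:(lra))). unfold h. rewrite Hh by auto.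
    destruct (Hxs n) as [_ [Hn3 Hn4]]. specialize (Hn4 x ltac:(lra)).
    pose proof (Hmono (xs n) x Hx ltac:(specialize (Hpx n); lra)).
    pose proof (Hmono x (xs (S n)) (HUx _) ltac:(lra)).
    pose proof (chord_slope_mult f xs n Hn3) as Hsl.
    set (sl := chord_slope f xs n) in *.
    assert (0 <= sl).
    { apply Rnot_lt_le. intros Hlt. nra. }
    assert (0 <= sl * (x - xs n)) by (apply Rmult_le_pos; lra).
    assert (sl * (x - xs n) <= sl * (xs (S n) - xs n)) by (apply Rmult_le_compat_l; lra).
    apply Rabs_le. lra.
  - intros x Hx Hpx'. rewrite HTe by auto. specialize (Hdb x Hx).
    assert (Hx0 : x <= xs 1%nat) by (specialize (Hinc O); lra).
    rewrite (is_series_unique _ _ (Hhs x O Hx0)). rewrite sum_O. unfold h.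
    rewrite Rmax_left by lra. apply Rabs_le. specialize (Hepos x Hx). lra.
Qed.

(** The slope is the left derivative at p, the supremum of the slopes of the chords
that end at p. *)
Lemma support_line U f p : open_convex U -> U p -> convex_on U f ->
  exists k, forall x, U x -> f p + k * (x - p) <= f x.
Proof.
  intros HU Hp Hf. destruct (proj2 HU p Hp) as [d [Hd HUd]].
  assert (Hb : U (p + d)) by (apply HUd; apply Rabs_le; lra).
  assert (Ha : U (p - d)) by (apply HUd; apply Rabs_le; lra).
  set (E := fun s => exists x, U x /\ x < p /\ s * (p - x) = f p - f x).
  assert (HE : forall z, U z -> p < z -> forall s, E s -> s * (z - p) <= f z - f p).
  { intros z Hz Hpz s [x [Hx [Hxp Hs]]].
    pose proof (convex_3 U f x p z Hf Hx Hz ltac:(lra) ltac:(lra)).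
    apply Rmult_le_reg_r with (p - x); [lra|]. nra. }
  destruct (completeness E) as [k [Hk1 Hk2]].
  - exists ((f (p + d) - f p) / d). intros s Hs. specialize (HE _ Hb ltac:(lra) s Hs).
    apply Rmult_le_reg_r with d; auto. unfold Rdiv. rewrite Rmult_assoc, Rinv_l by lra. lra.
  - exists ((f p - f (p - d)) / d), (p - d). split; auto. split; [lra|]. field. lra.
  - exists k. intros x Hx. destruct (Rtotal_order x p) as [H|[->|H]]; [|lra|].
    + assert (HEx : E ((f p - f x) / (p - x))).
      { exists x. split; auto. split; auto. field. lra. }
      apply Hk1 in HEx. apply Rmult_le_compat_r with (r := p - x) in HEx; [|lra].
      unfold Rdiv in HEx. rewrite Rmult_assoc, Rinv_l in HEx by lra. lra.
    + enough (k <= (f x - f p) / (x - p)) as Hk.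
      { apply Rmult_le_compat_r with (r := x - p) in Hk; [|lra].
        unfold Rdiv in Hk. rewrite Rmult_assoc, Rinv_l in Hk by lra. lra. }
      apply Hk2. intros s Hs. specialize (HE x Hx H s Hs).
      apply Rmult_le_reg_r with (x - p); [lra|]. unfold Rdiv. rewrite Rmult_assoc, Rinv_l by lra. lra.
Qed.

Lemma open_convex_of_is_open_interval U : is_open_interval U -> open_convex U.
Proof.
  intros [a [b H]]. split.
  - intros x y z Hx Hz Hy. apply H in Hx, Hz. apply H. split.
    + apply Rbar_lt_le_trans with x; [apply Hx | apply Hy].
    + apply Rbar_le_lt_trans with z; [apply Hy | apply Hz].
  - intros x Hx. apply H in Hx. destruct Hx as [Hx1 Hx2].
    destruct (open_and _ _ (open_Rbar_gt a) (open_Rbar_lt b) x (conj Hx1 Hx2)) as [d Hd].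
    exists (d / 2). pose proof (cond_pos d). split; [lra|]. intros y Hy. apply H, Hd.
    change (Rabs (y - x) < d). lra.
Qed.

Lemma bounded_below_of_continuous U eps : open_convex U -> continuous_on U eps ->
  (forall x, U x -> 0 < eps x) -> bounded_below_on_compacts U eps.
Proof.
  intros HU Hc Hpos a b Ha Hb. destruct (Rle_dec a b) as [Hab|Hab].
  - destruct (continuity_ab_min eps a b Hab) as [m [Hm1 Hm2]].
    + intros x Hx. assert (HUx : U x) by now apply (proj1 HU a x b).
      apply continuity_pt_filterlim. intros P HP. specialize (Hc x HUx P HP).
      destruct (proj2 HU x HUx) as [d [Hd HUd]].
      assert (HUl : locally x U).
      { exists (mkposreal d Hd). intros y Hy. apply HUd. left; exact Hy. }
      change (locally x (fun y => U y -> P (eps y))) in Hc.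
      change (locally x (fun y => P (eps y))).
      generalize (filter_and _ _ Hc HUl). apply filter_imp. intros y [H1 H2]. exact (H1 H2).
    + exists (eps m). split; auto. apply Hpos. now apply (proj1 HU a m b).
  - exists 1. split; [lra|]. intros; lra.
Qed.

Theorem theorem3 (U : R -> Prop) (HU : is_open_interval U)
    (f : R -> R) (Hf : convex_on U f)
    (eps : R -> R) (Heps : continuous_on U eps)
    (Heps_pos : forall x : R, U x -> 0 < eps x) :
  exists g : R -> R,
    analytic_on U g /\ convex_on U g /\
    (forall x : R, U x -> Rabs (f x - g x) <= eps x).
Proof.
  destruct (classic (exists p, U p)) as [[p Hp]|Hempty].
  2:{ exists f. split; [|split]; auto.
      - intros x Hx. exfalso. apply Hempty. now exists x.
      - intros x Hx. exfalso. apply Hempty. now exists x. }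
  apply open_convex_of_is_open_interval in HU.
  pose proof (bounded_below_of_continuous U eps HU Heps Heps_pos) as Hbb.
  destruct (support_line U f p HU Hp Hf) as [k Hk].
  set (f1 := fun x => f x - (f p + k * (x - p))).
  set (e := fun x => Rmin (eps x / 2) 1).
  assert (He : bounded_below_on_compacts U e).
  { intros a b Ha Hb. destruct (Hbb a b Ha Hb) as [m [Hm H]]. exists (Rmin (m / 2) 1). split.
    - apply Rmin_glb_lt; lra.
    - intros x Hx. specialize (H x Hx). unfold e. apply Rle_min_compat_r. lra. }
  assert (He1 : forall x, e x <= 1) by (intros; apply Rmin_r).
  assert (He2 : forall x, e x <= eps x / 2) by (intros; apply Rmin_l).
  assert (Hf1 : convex_on U f1).
  { intros x y t Hx Hy Ht. specialize (Hf x y t Hx Hy Ht). unfold f1. lra. }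
  assert (Hf10 : forall x, U x -> 0 <= f1 x).
  { intros x Hx. specialize (Hk x Hx). unfold f1. lra. }
  assert (Hf1p : f1 p = 0) by (unfold f1; ring).
  destruct (right_half U p f1 e) as [g [G1 [G2 [G3 G4]]]]; auto.
  destruct (right_half (fun x => U (- x)) (- p) (fun x => f1 (- x)) (fun x => e (- x)))
    as [g' [G1' [G2' [G3' G4']]]]; auto; rewrite ?Ropp_involutive; auto.
  { now apply open_convex_opp. }
  { now apply bounded_below_opp. }
  { intros x y t Hx Hy Ht.
    replace (- (t * x + (1 - t) * y)) with (t * - x + (1 - t) * - y) by ring. now apply Hf1. }
  apply expandable_on_opp in G1'.
  exists (fun x => g x + g' (- x) + (f p + k * (x - p))). split; [|split].
  - intros x0 Hx0.
    assert (HA : expandable_on U (fun x => g x + g' (- x) + (f p + k * (x - p)))).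
    { apply (expandable_on_plus U (fun x => g x + g' (- x))); [now apply expandable_on_plus|].
      intros x _. exists 1. eexists.
      apply expansion_ext with (fun z => (f p + k * (x - p)) + k * (z - x)); [intros; ring|].
      apply expansion_affine. lra. }
    destruct (HA x0 Hx0) as [r [M HM]]. now apply expansion_analytic_at with r M.
  - intros x y t Hx Hy Ht. specialize (G2 x y t Hx Hy Ht).
    specialize (G2' (- x) (- y) t). cbv beta in G2'. rewrite !Ropp_involutive in G2'. specialize (G2' Hx Hy Ht).
    replace (- (t * x + (1 - t) * y)) with (t * - x + (1 - t) * - y) by ring. lra.
  - intros x Hx. specialize (He2 x).
    replace (f x - (g x + g' (- x) + (f p + k * (x - p)))) with (f1 x - g x - g' (- x)) by (unfold f1; ring).
    specialize (G3' (- x)). specialize (G4' (- x)). cbv beta in G3', G4'. rewrite !Ropp_involutive in *.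
    destruct (Rle_dec p x) as [Hpx|Hpx].
    + specialize (G3 x Hx Hpx). specialize (G4' Hx ltac:(lra)).
      apply Rabs_le_between in G3, G4'. apply Rabs_le. lra.
    + specialize (G4 x Hx ltac:(lra)). specialize (G3' Hx ltac:(lra)).
      apply Rabs_le_between in G4, G3'. apply Rabs_le. lra.
Qed.
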